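(* Let $(M,d)$ be a metric space and let $Y$ be a bounded subset of $M$. Let $\mathcal{N}$ be a $\sigma$-algebra of subsets of $Y$ containing all Borel subsets of $Y$, and let $\nu$ be a measure on $\mathcal{N}$ such that $\nu(B(x,r)\cap Y)<+\infty$ for all $x\in Y$, $r>0$. Let $\upsilon_Y\in]0,+\infty[$ and assume that $Y$ is upper $\upsilon_Y$-Ahlfors regular with respect to $Y$. Let $\theta\in]0,1]$, $s_1\in[0,\upsilon_Y[\cap[\upsilon_Y-1,\upsilon_Y[$, $s_2\in[0,+\infty[$, $s_3\in]0,1]$. If $s_2=\upsilon_Y$, assume furthermore that $Y$ is strongly upper $\upsilon_Y$-Ahlfors regular with respect to $Y$; if $s_2>\upsilon_Y$, assume furthermore that $s_2<\upsilon_Y+s_3$. Let $\varpi:[0,+\infty[\to[0,+\infty[$ be defined by $\varpi(0)\equiv0$ and, for $r>0$, \[ \varpi(r)\equiv\begin{cases} r^{\min\{\upsilon_Y-s_1,s_3\}} &\text{if } s_2<\upsilon_Y,\\ \max\{r^{\upsilon_Y-s_1},\omega_{s_3}(r)\}&\text{if } s_2=\upsilon_Y,\\ r^{\min\{\upsilon_Y-s_1,\,s_3+\upsilon_Y-s_2\}}&\text{if } s_2>\upsilon_Y.\end{cases} \] Let $K\in\mathcal{K}_{s_1,s_2,s_3}(Y\times Y)$ and let $A[K,\mu](x)\equiv\int_Y K(x,y)\mu(y)\,d\nu(y)$, $x\in Y$, for $\mu\in L^2_\nu(Y)$. If $g\in C^{0,\theta}_b(Y)$ and $\mu\in L^2_\nu(Y)$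 satisfies $\mu-A[K,\mu]=g$ $\nu$-a.e. in $Y$, then $\mu\in C^{0,\max\{r^\theta,\varpi(r)\}}_b(Y)$.
   Context: For $\xi\in M$, $r>0$, $B(\xi,r)=\{\eta\in M: d(\xi,\eta)<r\}$, and $B(\xi,0)=\emptyset$. $Y$ is upper $\upsilon$-Ahlfors regular with respect to $Y$ if there exist $r_0\in]0,+\infty]$, $c_0\in]0,+\infty[$ with $\nu(B(x,r)\cap Y)\leq c_0r^{\upsilon}$ for all $x\in Y$, $r\in]0,r_0[$; strongly upper $\upsilon$-Ahlfors regular with respect to $Y$ if there exist $r_0\in]0,+\infty]$, $c_0\in]0,+\infty[$ with $\nu((B(x,r_2)\setminus B(x,r_1))\cap Y)\leq c_0(r_2^{\upsilon}-r_1^{\upsilon})$ for all $x\in Y$, $r_1,r_2\in[0,r_0[$, $r_1<r_2$. For $a_1,a_2,a_3\in\mathbb{R}$, $\mathcal{K}_{a_1,a_2,a_3}(Y\times Y)$ is the set of continuous $K:\{(x,y)\in Y^2:x\neq y\}\to\mathbb{C}$ such that $\sup\{d(x,y)^{a_1}|K(x,y)|: x\neq y\}<+\infty$ and $\sup\{\frac{d(x',y)^{a_2}}{d(x',x'')^{a_3}}|K(x',y)-K(x'',y)|: x',x''\in Y, x'\neq x'', y\in Y\setminus B(x',2d(x',x''))\}<+\infty$. For $\theta\in]0,1]$, $\omega_\theta(0)=0$, $\omega_\theta(r)=r^\theta|\ln r|$ for $r\in]0,e^{-1/\theta}]$, $\omega_\theta(r)=e^{-1}\cdot\frac{1}{\theta}$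 (i.e. $r_\theta^\theta|\ln r_\theta|$ with $r_\theta=e^{-1/\theta}$) for $r>e^{-1/\theta}$. For a function $\omega:[0,+\infty[\to[0,+\infty[$, $C^{0,\omega(\cdot)}_b(Y)$ is the set of bounded continuous $f:Y\to\mathbb{C}$ with $\sup\{|f(x)-f(y)|/\omega(d(x,y)): x,y\in Y,x\neq y\}<+\infty$; $C^{0,\theta}_b(Y)$ denotes the case $\omega(r)=r^\theta$. Membership of $\mu\in L^2_\nu(Y)$ in such a space means $\mu$ has a representative in it. *)

(* Defs.v *)
From HB Require Import structures.
From mathcomp Require Import all_boot all_order all_algebra.
From mathcomp Require Import all_classical all_reals all_analysis.
From mathcomp Require Import complex.
Set Implicit Arguments. Unset Strict Implicit. Unset Printing Implicit Defensive.
Import Order.TTheory GRing.Theory Num.Theory.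
Local Open Scope classical_set_scope.
Local Open Scope ring_scope.

Section Defs.
Variable R : realType.
Variable M : Type.
Variable d : M -> M -> R.

Definition is_metric : Prop :=
  (forall x y, 0 <= d x y) /\ (forall x y, d x y = 0 <-> x = y) /\
  (forall x y, d x y = d y x) /\ (forall x y z, d x z <= d x y + d y z).

(* open ball B(x,r) = {y : d(x,y) < r}; for r = 0 this is empty *)
Definition ball_d (x : M) (r : R) : set M := [set y | d x y < r].

Definition d_open (U : set M) : Prop :=
  forall x, U x -> exists2 r : R, 0 < r & ball_d x r `<=` U.

Definition d_bounded (Y : set M) : Prop :=
  exists C : R, forall x y, Y x -> Y y -> d x y <= C.

Definition cabs (z : R[i]) : R := Num.sqrt (complex.Re z ^+ 2 + complex.Im z ^+ 2).

Definition d_cont_on (Y : set M) (f : M -> R[i]) : Prop :=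
  forall x, Y x -> forall e : R, 0 < e -> exists2 del : R, 0 < del &
    forall y, Y y -> d x y < del -> cabs (f y - f x) < e.

Definition bounded_on (Y : set M) (f : M -> R[i]) : Prop :=
  exists C : R, forall x, Y x -> cabs (f x) <= C.

Definition Cb_omega (omega : R -> R) (Y : set M) (f : M -> R[i]) : Prop :=
  d_cont_on Y f /\ bounded_on Y f /\
  exists C : R, forall x y, Y x -> Y y -> x <> y ->
    cabs (f x - f y) / omega (d x y) <= C.

Definition Cb_hold (theta : R) (Y : set M) (f : M -> R[i]) : Prop :=
  Cb_omega (fun r => r `^ theta) Y f.

(* the class K_{a1,a2,a3}(Y x Y); K is only considered off the diagonal of Y x Y *)
Definition kernel_class (a1 a2 a3 : R) (Y : set M) (K : M -> M -> R[i]) : Prop :=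
  (forall x y, Y x -> Y y -> x <> y -> forall e : R, 0 < e ->
     exists2 del : R, 0 < del & forall x1 y1, Y x1 -> Y y1 -> x1 <> y1 ->
       d x x1 < del -> d y y1 < del -> cabs (K x1 y1 - K x y) < e) /\
  (exists C : R, forall x y, Y x -> Y y -> x <> y ->
     (d x y) `^ a1 * cabs (K x y) <= C) /\
  (exists C : R, forall x' x'' y, Y x' -> Y x'' -> x' <> x'' -> Y y ->
     ~ ball_d x' (2 * d x' x'') y ->
     (d x' y) `^ a2 / (d x' x'') `^ a3 * cabs (K x' y - K x'' y) <= C).

Definition omega_th (theta r : R) : R :=
  if r == 0 then 0
  else if r <= expR (- theta^-1) then r `^ theta * `| ln r |
  else expR (-1) * theta^-1.

Definition varpi (upsY s1 s2 s3 r : R) : R :=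
  if r == 0 then 0
  else if s2 < upsY then r `^ (Num.min (upsY - s1) s3)
  else if s2 == upsY then Num.max (r `^ (upsY - s1)) (omega_th s3 r)
  else r `^ (Num.min (upsY - s1) (s3 + upsY - s2)).

End Defs.

Section MeasDefs.
Local Open Scope ereal_scope.
Context {R : realType} {dM : measure_display} {M : measurableType dM}.
Variable d : M -> M -> R.
Variable nu : {measure set M -> \bar R}.

Definition upper_ahlfors (ups : R) (Y : set M) : Prop :=
  exists r0 : \bar R, exists c0 : R, 0 < r0 /\ (0 < c0)%R /\
    forall x (r : R), Y x -> (0 < r)%R -> r%:E < r0 ->
      nu (ball_d d x r `&` Y) <= (c0 * r `^ ups)%:E.

Definition strongly_upper_ahlfors (ups : R) (Y : set M) : Prop :=
  exists r0 : \bar R, exists c0 : R, 0 < r0 /\ (0 < c0)%R /\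
    forall x (r1 r2 : R), Y x -> (0 <= r1)%R -> (r1 < r2)%R -> r2%:E < r0 ->
      nu ((ball_d d x r2 `\` ball_d d x r1) `&` Y)
        <= (c0 * (r2 `^ ups - r1 `^ ups))%:E.

Definition cmeasurable (Y : set M) (f : M -> R[i]) : Prop :=
  measurable_fun Y (fun x => complex.Re (f x)) /\ measurable_fun Y (fun x => complex.Im (f x)).

(* L^2_nu(Y) (as functions; membership of a class = membership of a representative) *)
Definition L2 (Y : set M) (f : M -> R[i]) : Prop :=
  cmeasurable Y f /\
  \int[nu]_(x in Y) ((cabs (f x)) ^+ 2)%:E < +oo.

Definition cintegral (Y : set M) (f : M -> R[i]) : R[i] :=
  Complex (Rintegral nu Y (fun y => complex.Re (f y))) (Rintegral nu Y (fun y => complex.Im (f y))).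

Definition layer_op (Y : set M) (K : M -> M -> R[i]) (mu : M -> R[i]) (x : M) : R[i] :=
  cintegral Y (fun y => (K x y * mu y)%R).

End MeasDefs.

(* Main.v *)
(* On balls of radii [rho * e^k], upper Ahlfors regularity turns
   every integral of a power of the distance into a geometric series.

   Boundedness of mu: the part of the kernel near the diagonal has norm at most 1/2 on
   bounded functions and on L^1 once its range is small, and the rest maps L^1 to bounded
   functions; comparing [mu] with its truncation then gives a bound a.e. As [Y] need not be
   separable, the distance need not be measurable for the product sigma-algebra, so the L^1
   bound cannot come from Tonelli's theorem; it is proved scale by scale from countably many
   balls.

   Regularity: for bounded mu, the difference [A mu x' - A mu x''] is split at the ball of
   radius [2 d(x',x'')] around x'; when s2 is the Ahlfors exponent the outer part is a sum of
   O(|ln d(x',x'')|) equal terms. *)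

(* The majorants of [d x y ^ (- s)] are series of multiples of ball indicators, so only balls have
   to be measured, and the Ahlfors bound applies to each term. At [y = x] such a series is [+oo] and
   dominates any value of [K x x]; this costs nothing, because its integral is finite. With ratio e
   between consecutive radii, the number of scales between t and 1 is [|ln t|] up to rounding, which
   is the logarithm in [omega_th]. The truncation is needed because [mu] is not known to be bounded,
   so a contraction in the sup norm alone might compare infinity with itself. The L^1 norm is finite
   from the start, and there a contraction can be used. Both norms enter: the sup norm for the
   constant split off by the truncation, L^1 for the excess over it. The equation holds only a.e.,
   so regularity is proved for [g + A[K, mu]], which has a value at every point of [Y]. *)
Require Import Defs.
From HB Require Import structures.
From mathcomp Require Import all_boot all_order all_algebra.
From mathcomp Require Import all_classical all_reals all_analysis.
From mathcomp Require Import complex.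
From mathcomp Require Import measurable_realfun ring lra.
Import Order.TTheory GRing.Theory Num.Theory.
Local Open Scope classical_set_scope.
Local Open Scope ring_scope.
Set Implicit Arguments. Unset Strict Implicit. Unset Printing Implicit Defensive.

(** * Moduli of continuity *)

Section Moduli.
Context {R : realType}.
Implicit Types a b t s : R.

Lemma powR_decr a b t : 0 < t -> t <= 1 -> a <= b -> t `^ b <= t `^ a.
Proof.
move=> t0 t1 ab; rewrite /powR gt_eqF// ler_expR ler_wnM2r//.
exact: ln_le0.
Qed.

Lemma small_le1 s : 0 < s -> expR (- s^-1) <= 1.
Proof. by move=> s0; rewrite expR_le1 oppr_le0 invr_ge0 ltW. Qed.

(** In the critical case this absorbs additive constants into the logarithm. *)
Lemma abs_ln_ge1 s t : 0 < s <= 1 -> 0 < t -> t <= expR (- s^-1) -> 1 <= `|ln t|.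
Proof.
move=> /andP[s0 s1] t0 ts.
have lnt : ln t <= - s^-1 by rewrite -(expRK (- s^-1)) ler_ln ?posrE ?expR_gt0.
have s1' : 1 <= s^-1 by rewrite invf_ge1.
rewrite ler0_norm; lra.
Qed.

Lemma omega_thE s t : 0 < t -> t <= expR (- s^-1) -> omega_th s t = t `^ s * `|ln t|.
Proof. by move=> t0 ts; rewrite /omega_th gt_eqF// ts. Qed.

(** Half of the exponent pays for the logarithm: [ln v < v] is applied to [v = t ^ (- s / 2)]. *)
Lemma omega_th_le s t : 0 < s -> 0 < t -> t <= expR (- s^-1) ->
  omega_th s t <= 2 / s * t `^ (s / 2).
Proof.
move=> s0 t0 ts; rewrite omega_thE//.
have lnt : ln t <= 0 by apply: ln_le0; exact: le_trans (small_le1 s0).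
rewrite ler0_norm//.
have /ltW : ln (t `^ (- (s / 2))) < t `^ (- (s / 2)).
  by apply: ln_sublinear; rewrite powR_gt0.
rewrite ln_powR => h.
have -> : t `^ s = t `^ (s / 2) * t `^ (s / 2).
  rewrite -powRD ?(gt_eqF t0) ?implybT//; congr (_ `^ _); lra.
have p0 : 0 < t `^ (s / 2) by rewrite powR_gt0.
have {h} : t `^ (s / 2) * (- (s / 2) * ln t) <= 1.
  by rewrite -ler_pdivlMl// mulr1 -powRN.
have -> : - ln t = 2 / s * (- (s / 2) * ln t) by field; rewrite gt_eqF.
move: (t `^ _) (- (s / 2) * _) p0 => p q p0 pq.
have -> : p * p * (2 / s * q) = 2 / s * p * (p * q) by ring.
by rewrite ler_piMr// mulr_ge0 ?divr_ge0// ltW.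
Qed.

(** A positive power forces [varpi] to tend to 0 at 0, which is what the continuity of the
    representative rests on. For [ups < s2] the exponent is positive because [s2 < ups + s3]. *)
Lemma varpi_le_powR ups s1 s2 s3 : s1 < ups -> 0 < s3 -> (ups < s2 -> s2 < ups + s3) ->
  exists C a, [/\ 0 <= C, 0 < a & forall t, 0 < t -> t <= expR (- s3^-1) ->
    varpi ups s1 s2 s3 t <= C * t `^ a].
Proof.
move=> s1ups s30 s2ups.
have [lt2|ge2] := ltP s2 ups.
  exists 1, (Num.min (ups - s1) s3); split => //; first by rewrite lt_min subr_gt0 s1ups.
  by move=> t t0 _; rewrite /varpi gt_eqF// lt2 mul1r.
have [eq2|ne2] := eqVneq s2 ups.
  exists (1 + 2 / s3), (Num.min (ups - s1) (s3 / 2)); split.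
  - by rewrite addr_ge0// divr_ge0// ltW.
  - by rewrite lt_min subr_gt0 s1ups divr_gt0.
  move=> t t0 ts; rewrite /varpi gt_eqF// ltNge ge2 eq2 eqxx /=.
  have t1 : t <= 1 := le_trans ts (small_le1 s30).
  have s3' : 0 <= 2 / s3 by rewrite divr_ge0// ltW.
  have p0 : 0 <= t `^ Num.min (ups - s1) (s3 / 2) by exact: powR_ge0.
  rewrite ge_max mulrDl mul1r; apply/andP; split.
    apply: (@le_trans _ _ (t `^ Num.min (ups - s1) (s3 / 2))).
      by apply: powR_decr => //; rewrite ge_min lexx.
    by rewrite lerDl mulr_ge0.
  apply: le_trans (omega_th_le s30 t0 ts) _.
  apply: (@le_trans _ _ (2 / s3 * t `^ Num.min (ups - s1) (s3 / 2))).
    by rewrite ler_wpM2l// powR_decr// ge_min lexx orbT.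
  by rewrite lerDr.
have gt2 : ups < s2 by rewrite lt_neqAle eq_sym ne2.
exists 1, (Num.min (ups - s1) (s3 + ups - s2)); split => //.
  rewrite lt_min subr_gt0 s1ups /=; have := s2ups gt2; lra.
by move=> t t0 _; rewrite /varpi gt_eqF// ltNge ge2 (negbTE ne2) /= mul1r.
Qed.

End Moduli.

(** * Complex-valued functions and integrals *)

Section ComplexModulus.
Variable R : realType.
Implicit Types z w : R[i].

Lemma cabsE z : cabs z = ComplexField.Normc.normc z.
Proof. by case: z. Qed.

Lemma cabs_ge0 z : 0 <= cabs z.
Proof. exact: sqrtr_ge0. Qed.

Lemma cabsM z w : cabs (z * w) = cabs z * cabs w.
Proof. by rewrite !cabsE ComplexField.Normc.normcM. Qed.

Lemma cabsD z w : cabs (z + w) <= cabs z + cabs w.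
Proof. by rewrite !cabsE; exact: le_normcD. Qed.

Lemma cabsN z : cabs (- z) = cabs z.
Proof. by rewrite !cabsE normcN. Qed.

Lemma cabsB z w : cabs (z - w) <= cabs z + cabs w.
Proof. by rewrite -(cabsN w); exact: cabsD. Qed.

Lemma Re_le_cabs z : `|complex.Re z| <= cabs z.
Proof. by rewrite -sqrtr_sqr ler_wsqrtr// lerDl sqr_ge0. Qed.

Lemma Im_le_cabs z : `|complex.Im z| <= cabs z.
Proof. by rewrite -sqrtr_sqr ler_wsqrtr// lerDr sqr_ge0. Qed.

Lemma cabs_le_ReIm z : cabs z <= `|complex.Re z| + `|complex.Im z|.
Proof.
rewrite -[leRHS]ger0_norm ?addr_ge0// -sqrtr_sqr ler_wsqrtr//.
by rewrite sqrrD !real_normK ?num_real// addrAC lerDl mulrn_wge0 ?mulr_ge0.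
Qed.

End ComplexModulus.

Section ComplexIntegral.
Context {R : realType} {dM : measure_display} {M : measurableType dM}.
Variables (nu : {measure set M -> \bar R}) (Y : set M).
Hypothesis mY : measurable Y.
Implicit Types f g : M -> R[i].

Lemma measurable_cabs f : cmeasurable Y f -> measurable_fun Y (fun y => cabs (f y)).
Proof.
move=> [mRe mIm]; rewrite /cabs.
apply: (measurableT_comp (f := @Num.sqrt R)); last first.
  by apply: measurable_funD; apply: measurable_funX.
by apply: continuous_measurable_fun; exact: sqrt_continuous.
Qed.

Lemma cmeasurableB f g : cmeasurable Y f -> cmeasurable Y g ->
  cmeasurable Y (fun y => f y - g y).
Proof.
move=> [fr fi] [gr gi]; split.
  apply: (eq_measurable_fun (fun y => complex.Re (f y) - complex.Re (g y))).
    by move=> y _; case: (f y) => ? ?; case: (g y).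
  exact: measurable_funB.
apply: (eq_measurable_fun (fun y => complex.Im (f y) - complex.Im (g y))).
  by move=> y _; case: (f y) => ? ?; case: (g y).
exact: measurable_funB.
Qed.

Lemma cmeasurableM f g : cmeasurable Y f -> cmeasurable Y g ->
  cmeasurable Y (fun y => f y * g y).
Proof.
move=> [fr fi] [gr gi]; split.
  apply: (eq_measurable_fun (fun y => complex.Re (f y) * complex.Re (g y)
    - complex.Im (f y) * complex.Im (g y))).
    by move=> y _; case: (f y) => ? ?; case: (g y).
  by apply: measurable_funB; exact: measurable_funM.
apply: (eq_measurable_fun (fun y => complex.Re (f y) * complex.Im (g y)
  + complex.Im (f y) * complex.Re (g y))).
  by move=> y _; case: (f y) => ? ?; case: (g y).
by apply: measurable_funD; exact: measurable_funM.
Qed.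

Lemma measurable_cabsE f : cmeasurable Y f ->
  measurable_fun Y (fun y => (cabs (f y))%:E).
Proof. by move=> mf; apply/measurable_EFinP/measurable_cabs. Qed.

Lemma le_abs_Rintegral (h : M -> R) : measurable_fun Y h ->
  (`|Rintegral nu Y h|%:E <= \int[nu]_(y in Y) `|h y|%:E)%E.
Proof.
move=> mh; apply: (@le_trans _ _ `|\int[nu]_(y in Y) (h y)%:E|%E); last first.
  exact/(le_abse_integral nu mY)/measurable_EFinP.
(* For an infinite integral [fine] returns 0, so the bound survives. *)
by rewrite /Rintegral; case: (integral _ _ _) => [r| |] //=; rewrite normr0 ?leey.
Qed.

(* The bound also holds when [f] is not integrable: the right-hand side is then
   infinite, whatever junk value the left-hand side takes. *)
Lemma cabs_cintegral_le f : cmeasurable Y f ->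
  ((cabs (cintegral nu Y f))%:E <= 2%:E * \int[nu]_(y in Y) (cabs (f y))%:E)%E.
Proof.
move=> mf; have [mRe mIm] := mf.
apply: (@le_trans _ _ (`|complex.Re (cintegral nu Y f)|%:E
    + `|complex.Im (cintegral nu Y f)|%:E)%E).
  by rewrite -EFinD lee_fin cabs_le_ReIm.
rewrite (_ : 2%:E = 1 + 1)%E; last by rewrite -EFinD.
rewrite ge0_muleDl// !mul1e; apply: leeD => /=.
- apply: le_trans (le_abs_Rintegral mRe) _.
  apply: ge0_le_integral => //; [|exact: measurable_cabsE|].
    by apply/measurable_EFinP; exact: measurableT_comp.
  by move=> y _; rewrite lee_fin Re_le_cabs.
- apply: le_trans (le_abs_Rintegral mIm) _.
  apply: ge0_le_integral => //; [|exact: measurable_cabsE|].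
    by apply/measurable_EFinP; exact: measurableT_comp.
  by move=> y _; rewrite lee_fin Im_le_cabs.
Qed.

Lemma cabs_integrable f : cmeasurable Y f ->
  (\int[nu]_(y in Y) (cabs (f y))%:E < +oo)%E ->
  nu.-integrable Y (EFin \o (fun y => complex.Re (f y))) /\
  nu.-integrable Y (EFin \o (fun y => complex.Im (f y))).
Proof.
move=> mf fi; have [mRe mIm] := mf.
have If : nu.-integrable Y (EFin \o (fun y => cabs (f y))).
  apply/integrableP; split; first exact: measurable_cabsE.
  by under eq_integral do rewrite /= ger0_norm ?cabs_ge0//.
split; apply: (le_integrable mY _ _ If).
- exact/measurable_EFinP.
- by move=> y _ /=; rewrite lee_fin (ger0_norm (cabs_ge0 _)) Re_le_cabs.
- exact/measurable_EFinP.
- by move=> y _ /=; rewrite lee_fin (ger0_norm (cabs_ge0 _)) Im_le_cabs.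
Qed.

Lemma cintegralB f g : cmeasurable Y f -> cmeasurable Y g ->
  (\int[nu]_(y in Y) (cabs (f y))%:E < +oo)%E ->
  (\int[nu]_(y in Y) (cabs (g y))%:E < +oo)%E ->
  cintegral nu Y f - cintegral nu Y g = cintegral nu Y (fun y => f y - g y).
Proof.
move=> mf mg /(cabs_integrable mf)[fr fi] /(cabs_integrable mg)[gr gi].
rewrite /cintegral; apply/eqP; rewrite eq_complex /=; apply/andP; split; apply/eqP.
- rewrite -RintegralB//; apply: eq_Rintegral => y _.
  by case: (f y) => ? ?; case: (g y).
- rewrite -RintegralB//; apply: eq_Rintegral => y _.
  by case: (f y) => ? ?; case: (g y).
Qed.

End ComplexIntegral.

(** * Balls and measurability *)

Section MetricMeasure.
Context {R : realType} {dM : measure_display} {M : measurableType dM}.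
Variables (d : M -> M -> R) (Y : set M).
Hypotheses (dmet : is_metric d) (mY : measurable Y)
  (mopen : forall U, d_open d U -> measurable (U `&` Y)).

Definition dball x r : set M := ball_d d x r `&` Y.

Lemma dist_ge0 x y : 0 <= d x y. Proof. by case: dmet. Qed.

Lemma dist_refl x : d x x = 0. Proof. by case: dmet => _ [+ _] => /(_ x x)[_ ->]. Qed.

Lemma distC x y : d x y = d y x. Proof. by case: dmet => _ [_ [+ _]]; exact. Qed.

Lemma dist_tri y x z : d x z <= d x y + d y z.
Proof. by case: dmet => _ [_ [_ +]]; exact. Qed.

Lemma dist_gt0 x y : x <> y -> 0 < d x y.
Proof.
move=> xy; rewrite lt_neqAle dist_ge0 andbT; apply/eqP => /esym dxy.
by apply: xy; case: dmet => _ [+ _] => /(_ x y)[+ _]; exact.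
Qed.

Lemma open_ball_d x r : d_open d (ball_d d x r).
Proof.
move=> y xy; exists (r - d x y); first by rewrite subr_gt0.
move=> z /=; rewrite /ball_d /= ltrBrDl => yz.
exact: le_lt_trans (dist_tri y _ _) yz.
Qed.

Lemma measurable_dball x r : measurable (dball x r).
Proof. exact/mopen/open_ball_d. Qed.

Lemma open_setC1 x : d_open d (~` [set x]).
Proof.
move=> y /= yx; exists (d y x); first exact: dist_gt0.
by move=> z; rewrite /ball_d /= => yz zx; rewrite zx ltxx in yz.
Qed.

Lemma measurable_rel_continuous (V : set M) (f : M -> R) : d_open d V ->
  (forall y, Y y -> V y -> forall e, 0 < e -> exists2 del, 0 < del &
     forall z, Y z -> V z -> d y z < del -> `|f z - f y| < e) ->
  measurable_fun (V `&` Y) f.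
Proof.
move=> oV cf; apply: (measurability (RGenOInfty.G (R := R))).
  exact: RGenOInfty.measurableE.
move=> _ [_ [a ->] <-].
(* Only traces on [Y] of open sets are known to be measurable, so the preimage must be such a trace:
   [U] collects the balls on whose points in [Y] and [V] the function exceeds [a]. It is open in the
   whole space although [f] is controlled on [Y] alone. *)
pose U := V `&` [set y | exists2 z, (exists2 r, 0 < r /\ d z y < r &
  forall t, Y t -> V t -> d z t < r -> a < f t) & True].
rewrite (_ : _ `&` _ = U `&` Y).
  apply: mopen => y [Vy [z [r [r0 zy] zr] _]].
  have [s s0 sV] := oV _ Vy.
  exists (Num.min s (r - d z y)); first by rewrite lt_min s0 subr_gt0.
  move=> t; rewrite /ball_d /= lt_min => /andP[yt]; rewrite ltrBrDl => zt.
  split; first exact: sV.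
  exists z => //; exists r => //; split => //.
  exact: le_lt_trans (dist_tri y _ _) zt.
apply/seteqP; split=> y.
  move=> [[Vy Yy]] /=; rewrite in_itv /= andbT => ay; split => //; split => //.
  have fya : 0 < f y - a by rewrite subr_gt0.
  have [del del0 H] := cf y Yy Vy _ fya.
  exists y => //; exists del; first by rewrite dist_refl.
  move=> t Yt Vt /(H _ Yt Vt).
  by rewrite ltr_norml => /andP[+ _]; lra.
move=> [[Vy [z [r [r0 zy] zr] _]] Yy]; split => //=.
by rewrite in_itv /= andbT; exact: zr.
Qed.

(** Continuity is available only off the diagonal, so [Y] is split into the point [x], where every
    function is measurable, and its open complement. Real and imaginary parts are treated together
    as functionals that are 1-Lipschitz for [cabs]. *)
Lemma cmeasurable_kernel (K : M -> M -> R[i]) x : Y x ->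
  (forall x y, Y x -> Y y -> x <> y -> forall e : R, 0 < e ->
     exists2 del : R, 0 < del & forall x1 y1, Y x1 -> Y y1 -> x1 <> y1 ->
       d x x1 < del -> d y y1 < del -> cabs (K x1 y1 - K x y) < e) ->
  cmeasurable Y (K x).
Proof.
move=> Yx cK.
have mD : measurable (~` [set x] `&` Y) by exact/mopen/open_setC1.
have mx : measurable [set x].
  rewrite (_ : [set x] = Y `\` (~` [set x] `&` Y)); first exact: measurableD.
  apply/seteqP; split => y /=; first by move=> ->; split => // -[].
  by move=> [Yy] h; apply: contrapT => yx; exact: h.
have YE : Y = (~` [set x] `&` Y) `|` [set x].
  apply/seteqP; split => y /=; last by move=> [[]//|->].
  by move=> Yy; have [->|/eqP yx] := eqVneq y x; [right|left].
have main (f : R[i] -> R) : (forall z w, `|f z - f w| <= cabs (z - w)) ->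
    measurable_fun Y (fun y => f (K x y)).
  move=> fK; rewrite YE; apply/measurable_funU => //; split; last first.
    exact: measurable_fun_set1.
  apply: measurable_rel_continuous => [|y Yy /= xy e e0]; first exact: open_setC1.
  have [del del0 H] := cK x y Yx Yy (nesym xy) e e0.
  exists del => // z Yz zx yz; apply: le_lt_trans (fK _ _) _.
  by apply: H => //; [exact: nesym|rewrite dist_refl].
by split; apply: main => -[a b] [a' b'];
  [exact: (Re_le_cabs (Complex (a - a') (b - b')))
  |exact: (Im_le_cabs (Complex (a - a') (b - b')))].
Qed.

End MetricMeasure.

Section CountableCover.
Context {R : realType} {dM : measure_display} {M : measurableType dM}.
Variables (d : M -> M -> R) (Y : set M) (nu : {measure set M -> \bar R}).
Hypotheses (dmet : is_metric d) (mY : measurable Y)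
  (mopen : forall U, d_open d U -> measurable (U `&` Y))
  (nuY : (nu Y < +oo)%E).

Let mball := measurable_dball dmet mopen.

(* A countable union of [r]-balls of maximal measure meets every [r]-ball of
   positive measure; this replaces separability of [Y]. *)
Lemma countable_cover_positive_balls r : Y !=set0 ->
  exists2 z : nat -> M, (forall n, Y (z n)) &
    forall x, Y x -> (0 < nu (dball d Y x r))%E -> exists n, d x (z n) < r + r.
Proof.
move=> [y0 Yy0].
pose U (z : nat -> M) := \bigcup_n dball d Y (z n) r.
have mU z : measurable (U z) by apply: bigcup_measurable => n _; exact: mball.
have UY z : (nu (U z) <= nu Y)%E.
  by apply: le_measure; rewrite ?inE// => y [n _ []].
pose S := [set nu (U z) | z in [set z | forall n, Y (z n)]].
pose s := ereal_sup S.
have sY : (s <= nu Y)%E by apply: ge_ereal_sup => _ [z _ <-].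
have s0 : (0 <= s)%E.
  apply: (le_trans (measure_ge0 nu (U (fun=> y0)))).
  by apply: ereal_sup_ubound; exists (fun=> y0).
have sfin : s \is a fin_num by rewrite ge0_fin_numE// (le_lt_trans sY).
have /choice[Z HZ] : forall n, exists z, (forall k, Y (z k)) /\
    (s - (n.+1%:R^-1)%:E < nu (U z))%E.
  move=> n; have [||_ [z Yz <-] h] := @ub_ereal_sup_adherent _ S n.+1%:R^-1 => //.
  by exists z.
(* Coding pairs of indices merges the almost optimal sequences [Z n] into one sequence, so the
   supremum [s] is attained by [U z]. *)
pose z m := if unpickle m is Some (n, k) then Z n k else y0.
have Yz m : Y (z m).
  by rewrite /z; case: unpickle => // -[n k]; exact: (HZ n).1.
have sU : (s <= nu (U z))%E.
  apply/lee_addgt0Pr => e e0.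
  pose n := Num.truncn e^-1.
  have ne : n.+1%:R^-1 < e.
    by rewrite invf_plt ?posrE ?ltr0n// truncnS_gt.
  have ZU : (nu (U (Z n)) <= nu (U z))%E.
    apply: le_measure; rewrite ?inE// => y [k _ h].
    by exists (pickle (n, k)) => //; rewrite /z pickleK.
  apply: (@le_trans _ _ (nu (U (Z n)) + (n.+1%:R^-1)%:E)%E).
    by rewrite -leeBlDr// ltW//; exact: (HZ n).2.
  by apply: leeD => //; rewrite lee_fin ltW.
exists z => // x Yx xpos; apply: contrapT => noz.
have xz : dball d Y x r `&` U z = set0.
  apply/seteqP; split => // y [[xy Yy] [n _ [zy _]]]; apply: noz; exists n.
  apply: le_lt_trans (dist_tri dmet y _ _) _.
  by apply: ltrD; [exact: xy|rewrite (distC dmet)].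
(* If the ball at [x] missed [U z], prepending [x] would give a union of measure larger than [s], a
   contradiction because [nu (U z)] is finite. *)
pose z' n := if n is m.+1 then z m else x.
have : (nu (U z') <= s)%E by apply: ereal_sup_ubound; exists z' => //; case.
rewrite (_ : U z' = dball d Y x r `|` U z); last first.
  apply/seteqP; split => y.
    by move=> [[|n] _ h]; [left|right; exists n].
  by move=> [h|[n _ h]]; [exists 0%N|exists n.+1].
rewrite measureU// => h.
have : (nu (dball d Y x r) + nu (U z) <= nu (U z))%E := le_trans h sU.
have Ufin : nu (U z) \is a fin_num by rewrite ge0_fin_numE// (le_lt_trans (UY _)).
by rewrite -[leRHS]add0e leeD2rE// leNgt xpos.
Qed.

End CountableCover.

(** * Kernels that are constant on shells *)

Section Shells.
Context {R : realType} {dM : measure_display} {M : measurableType dM}.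
Variables (d : M -> M -> R) (Y : set M) (nu : {measure set M -> \bar R}).
Hypotheses (dmet : is_metric d) (mY : measurable Y)
  (mopen : forall U, d_open d U -> measurable (U `&` Y)).

Let mball := measurable_dball dmet mopen.

(** The summands live on balls, not on differences of balls: a lower bound needs only one term, and
    upper Ahlfors regularity controls balls directly. *)
Definition shell (a r : nat -> R) x y : \bar R :=
  (\sum_(k <oo) (a k * \1_(dball d Y x (r k)) y)%:E)%E.

Variables a r : nat -> R.
Hypothesis a0 : forall k, 0 <= a k.

Let term_ge0 x y k : (0 <= (a k * \1_(dball d Y x (r k)) y)%:E)%E.
Proof. by rewrite lee_fin mulr_ge0. Qed.

Lemma shell_ge0 x y : (0 <= shell a r x y)%E.
Proof. exact: nneseries_ge0. Qed.

Lemma measurable_shell D x : measurable_fun D (shell a r x).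
Proof.
apply: (measurable_funS measurableT) => //.
apply: ge0_emeasurable_sum => // k _; apply/measurable_EFinP.
by apply: measurable_funM => //; exact: measurable_indic.
Qed.

Lemma shell_ge k x y : Y y -> d x y < r k -> ((a k)%:E <= shell a r x y)%E.
Proof.
move=> Yy xy; rewrite /shell (nneseriesD1 (n := k))//.
rewrite indicE mem_set ?mulr1; last by split.
by apply: leeDl; exact: nneseries_ge0.
Qed.

Lemma integral_ball_indic (w : M -> R) x s :
  (\int[nu]_(y in Y) (w y * \1_(dball d Y x s) y)%:E =
   \int[nu]_(y in dball d Y x s) (w y)%:E)%E.
Proof.
rewrite [in RHS](_ : dball d Y x s = Y `&` dball d Y x s); last first.
  by apply/seteqP; split => y [] // ? [].
rewrite integral_mkcondr; apply: eq_integral => y _.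
by rewrite patchE indicE; case: ifPn => _; rewrite ?mulr1 ?mulr0.
Qed.

Lemma integral_shell (w : M -> R) x : measurable_fun Y w ->
  (forall y, Y y -> 0 <= w y) ->
  (\int[nu]_(y in Y) ((w y)%:E * shell a r x y) =
   \sum_(k <oo) (a k)%:E * \int[nu]_(y in dball d Y x (r k)) (w y)%:E)%E.
Proof.
move=> mw w0; rewrite /shell.
under eq_integral do rewrite -nneseriesZl//.
have mt k : measurable_fun Y (fun y => w y * \1_(dball d Y x (r k)) y).
  by apply: measurable_funM => //; exact: measurable_indic.
rewrite integral_nneseries//.
- apply: eq_eseriesr => k _; rewrite -integral_ball_indic -ge0_integralZl//.
  + by apply: eq_integral => y _; rewrite -!EFinM mulrCA.
  + exact/measurable_EFinP.
  + by move=> y Yy; rewrite lee_fin mulr_ge0// w0.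
  + by rewrite lee_fin.
- move=> k; apply/measurable_EFinP; apply: measurable_funM => //.
  by apply: measurable_funM => //; exact: measurable_indic.
- by move=> k y Yy; rewrite mule_ge0// lee_fin w0.
Qed.

Lemma nneseries_EFin_le (b : nat -> R) (C : R) : (forall k, 0 <= b k) ->
  (forall n, \sum_(k < n) b k <= C) -> (\sum_(k <oo) (b k)%:E <= C%:E)%E.
Proof.
move=> b0 bC; apply: lime_le; first by apply: is_cvg_nneseries => k _ _; rewrite lee_fin.
by apply: nearW => n; rewrite sumEFin lee_fin big_mkord.
Qed.

Variables c ups : R.
Hypothesis ahl : forall x s, Y x -> 0 < s -> (nu (dball d Y x s) <= (c * s `^ ups)%:E)%E.
Hypothesis r0 : forall k, 0 < r k.

Lemma integral_shell_le x (C : R) : Y x -> 0 <= c ->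
  (forall n, \sum_(k < n) a k * (c * r k `^ ups) <= C) ->
  (\int[nu]_(y in Y) shell a r x y <= C%:E)%E.
Proof.
move=> Yx c0 aC.
have -> : (\int[nu]_(y in Y) shell a r x y =
    \int[nu]_(y in Y) ((cst 1 y)%:E * shell a r x y))%E.
  by apply: eq_integral => y _; rewrite mul1e.
rewrite integral_shell//.
apply: le_trans (@nneseries_EFin_le (fun k => a k * (c * r k `^ ups)) _ _ aC); last first.
  by move=> k /=; rewrite !mulr_ge0 ?powR_ge0.
apply: lee_nneseries => k.
  by move=> _ _; rewrite mule_ge0 ?lee_fin ?integral_ge0.
move=> _; rewrite [in leRHS]EFinM lee_wpmul2l ?lee_fin//.
rewrite [leLHS](_ : _ = nu (dball d Y x (r k))); first exact: ahl.
by rewrite -[RHS]mul1e -(integral_cst nu (mball x (r k)) 1%E).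
Qed.

End Shells.

(** * Integrals over balls with moving centre *)

Section BallIntegrals.
Context {R : realType} {dM : measure_display} {M : measurableType dM}.
Variables (d : M -> M -> R) (Y : set M) (nu : {measure set M -> \bar R}).
Hypotheses (dmet : is_metric d) (mY : measurable Y)
  (mopen : forall U, d_open d U -> measurable (U `&` Y))
  (nuY : (nu Y < +oo)%E).

Let mball := measurable_dball dmet mopen.

(* Substitute for Tonelli's theorem on [{(x, y) | d x y < r}], a set that need
   not be measurable for the product sigma-algebra. *)
Lemma ball_integral_dominated (w : M -> R) (r A : R) : 0 < r ->
  measurable_fun Y w -> (forall y, Y y -> 0 <= w y) ->
  (forall y, Y y -> (nu (dball d Y y (5 * r)) <= A%:E)%E) ->
  exists F : M -> \bar R, [/\ measurable_fun Y F, forall x, (0 <= F x)%E,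
    forall x, Y x -> (\int[nu]_(y in dball d Y x r) (w y)%:E <= F x)%E &
    (\int[nu]_(x in Y) F x <= A%:E * \int[nu]_(y in Y) (w y)%:E)%E].
Proof.
move=> r0 mw w0 nuA.
have [->|/set0P Y0] := eqVneq Y set0.
  by exists (fun=> 0%E); split => //; rewrite !integral_set0 mule0.
have [z Yz zP] := countable_cover_positive_balls dmet mY mopen nuY r Y0.
have mwE : measurable_fun Y (fun y => (w y)%:E) by exact/measurable_EFinP.
have ballY x s : dball d Y x s `<=` Y by move=> y [].
(* Every [x] whose [r]-ball has positive measure lies in exactly one [Q j], within [2 r] of [z j].
   Its [r]-ball is then inside the ball of radius [3 r] at [z j], whose integral [m j] serves as a
   majorant constant on [Q j]. Null [r]-balls contribute nothing. *)
pose Q := seqDU (fun j => dball d Y (z j) (r + r)).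
have mQ j : measurable (Q j) by apply: seqDU_measurable => i; exact: mball.
have QB j : Q j `<=` dball d Y (z j) (r + r) by exact: subset_seqDU.
pose m j := (\int[nu]_(y in dball d Y (z j) (3 * r)) (w y)%:E)%E.
have m0 j : (0 <= m j)%E.
  by apply: integral_ge0 => y [_ Yy]; rewrite lee_fin w0.
have t0 j x : (0 <= m j * (\1_(Q j) x)%:E)%E by rewrite mule_ge0// lee_fin.
have mt j D : measurable_fun D (fun x => m j * (\1_(Q j) x)%:E)%E.
  by apply: measurable_funeM; apply/measurable_EFinP; exact: measurable_indic.
exists (fun x => \sum_(j <oo) m j * (\1_(Q j) x)%:E)%E; split.
- exact: ge0_emeasurable_sum.
- by move=> x; exact: nneseries_ge0.
- move=> x Yx; have [nx|nx] := leP (nu (dball d Y x r)) 0%E.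
    rewrite (_ : (\int[nu]_(y in _) _ = 0)%E); first exact: nneseries_ge0.
    transitivity (\int[nu]_(y in dball d Y x r) `|(w y)%:E|)%E.
      by apply: eq_integral => y; rewrite inE => -[_ Yy]; rewrite gee0_abs// lee_fin w0.
    apply: integral_abs_eq0; first exact: mball.
      by apply: measurable_funS mwE => //; exact: ballY.
    by apply/eqP; rewrite eq_le nx measure_ge0.
  have [n xzn] := zP x Yx nx.
  have [j _ Qjx] : (\bigcup_j Q j) x.
    rewrite -seqDU_bigcup_eq; exists n => //; split => //.
    by rewrite /ball_d /= (distC dmet).
  rewrite (nneseriesD1 (n := j))// indicE mem_set// mule1.
  apply: (@le_trans _ _ (m j)); last by apply: leeDl; exact: nneseries_ge0.
  apply: ge0_subset_integral => //; try exact: mball.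
  + by apply: measurable_funS mwE => //; exact: ballY.
  + by move=> y [_ Yy]; rewrite lee_fin w0.
  + move=> y [xy Yy]; split => //; have [zx _] := QB _ _ Qjx.
    rewrite /ball_d /= in xy zx *; have := dist_tri dmet x (z j) y; lra.
have mwB j : measurable_fun Y (fun y => (w y * \1_(dball d Y (z j) (3 * r)) y)%:E).
  by apply/measurable_EFinP; apply: measurable_funM => //; exact: measurable_indic.
have wB0 j y : Y y -> (0 <= (w y * \1_(dball d Y (z j) (3 * r)) y)%:E)%E.
  by move=> Yy; rewrite lee_fin mulr_ge0// w0.
rewrite integral_nneseries//.
(* This is the exchange of integrals for one [j]: the majorant is a product of a set in [x] and a
   set in [y], so [m j * nu (Q j)] may be read as an integral in [y]. *)
have -> : (\sum_(j <oo) \int[nu]_(x in Y) (m j * (\1_(Q j) x)%:E) =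
    \sum_(j <oo) \int[nu]_(y in Y)
      (nu (Q j) * (w y * \1_(dball d Y (z j) (3 * r)) y)%:E))%E.
  apply: eq_eseriesr => j _.
  rewrite ge0_integralZl//; last by apply/measurable_EFinP; exact: measurable_indic.
  rewrite integral_indic// setIidl; last by apply: subset_trans (QB j) _; exact: ballY.
  rewrite ge0_integralZl//; last exact: wB0.
  by rewrite integral_ball_indic muleC.
rewrite -integral_nneseries//; last 2 first.
- by move=> j; apply: measurable_funeM; exact: mwB.
- by move=> j y Yy; rewrite mule_ge0// wB0.
have A0 : (0 <= A%:E)%E by apply: le_trans (nuA _ (Yz 0%N)); exact: measure_ge0.
rewrite -ge0_integralZl//.
apply: ge0_le_integral => //.
- by move=> y Yy; apply: nneseries_ge0 => j _ _; rewrite mule_ge0// wB0.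
- apply: ge0_emeasurable_sum => [j y Yy _|j _]; first by rewrite mule_ge0// wB0.
  by apply: measurable_funeM; exact: mwB.
- exact: measurable_funeM.
move=> y Yy.
(* For fixed [y], [T j] is [Q j] or empty according to whether [z j] is within [3 r] of [y]. These
   sets are disjoint and lie in the ball of radius [2 r + 3 r] at [y], whence the 5 in the
   hypothesis on [A]. *)
pose T j := Q j `&` [set _ | d (z j) y < 3 * r].
have mT j : measurable (T j).
  rewrite /T; have [h|h] := pselect (d (z j) y < 3 * r).
    by rewrite (_ : [set _ | _] = setT) ?setIT//; apply/seteqP; split.
  by rewrite (_ : [set _ | _] = set0) ?setI0//; apply/seteqP; split.
have -> : (\sum_(j <oo) nu (Q j) * (w y * \1_(dball d Y (z j) (3 * r)) y)%:E =
    (w y)%:E * \sum_(j <oo) nu (T j))%E.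
  rewrite -nneseriesZl//; apply: eq_eseriesr => j _.
  rewrite muleC EFinM -muleA; congr (_ * _)%E.
  rewrite indicE /T; have [h|h] := pselect (d (z j) y < 3 * r).
    rewrite mem_set// mul1e (_ : [set _ | _] = setT) ?setIT//.
    by apply/seteqP; split.
  rewrite memNset; last by case.
  by rewrite mul0e (_ : [set _ | _] = set0) ?setI0 ?measure0//; apply/seteqP; split.
rewrite -measure_semi_bigcup//; last 2 first.
- by apply: trivIset_setIr; exact: trivIset_seqDU.
- exact: bigcup_measurable.
rewrite muleC lee_wpmul2r ?lee_fin ?w0//.
apply: le_trans (nuA _ Yy); apply: le_measure; rewrite ?inE//.
  exact: bigcup_measurable.
move=> x [j _ [/QB[zx Yx] /= zy]]; split => //.
rewrite /ball_d /= in zx *; have := dist_tri dmet (z j) y x.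
by rewrite (distC dmet y (z j)); lra.
Qed.

End BallIntegrals.

(** * Powers of the distance summed over exponential scales *)

Section ExponentialScales.
Context {R : realType}.
Implicit Types s t rho : R.

Lemma geometric_sum_le (A q : R) n : 0 <= A -> 0 < q -> q < 1 ->
  \sum_(k < n) A * q ^+ k <= A / (1 - q).
Proof.
move=> A0 q0 q1; rewrite -(big_mkord xpredT (fun k => A * q ^+ k)).
by apply: geometric_le_lim => //; rewrite gtr0_norm.
Qed.

Lemma ler_nat_expR (x : R) : exists n, x <= expR n%:R.
Proof.
exists (Num.truncn x).+1; apply: le_trans (ltW (truncnS_gt x)) _.
by apply: le_trans (expR_ge1Dx _); rewrite lerDr.
Qed.

(** The weight is taken at the inner radius of a shell and the measure at the outer one. This shift
    costs the factor [expR s], and the ratio [expR (- (t - s))] is below 1 exactly when [s < t]. *)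
Lemma near_term s t rho k : 0 < rho ->
  (rho * expR (- k.+1%:R)) `^ (- s) * (rho * expR (- k%:R)) `^ t =
  rho `^ (t - s) * expR s * expR (- (t - s)) ^+ k.
Proof.
move=> rho0; rewrite !powRM ?expR_ge0 ?ltW// -!expRM -expRM_natl.
rewrite mulrACA -powRD ?(gt_eqF rho0) ?implybT// -mulrA -!expRD (addrC (- s)).
by congr (_ * expR _); rewrite -natr1; ring.
Qed.

Lemma far_term s t rho k : 0 < rho ->
  (rho * expR k%:R) `^ (- s) * (rho * expR k.+1%:R) `^ t =
  rho `^ (t - s) * expR t * expR (- (s - t)) ^+ k.
Proof.
move=> rho0; rewrite !powRM ?expR_ge0 ?ltW// -!expRM -expRM_natl.
rewrite mulrACA -powRD ?(gt_eqF rho0) ?implybT// -mulrA -!expRD (addrC (- s)).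
by congr (_ * expR _); rewrite -natr1; ring.
Qed.

Lemma near_scale rho t : 0 < t -> t < rho ->
  exists k, rho * expR (- k.+1%:R) <= t < rho * expR (- k%:R).
Proof.
move=> t0 trho.
have ex : exists k, rho * expR (- k.+1%:R) <= t.
  have [n hn] := ler_nat_expR (rho / t); exists n.
  rewrite expRN -ler_pdivlMr ?invr_gt0 ?expR_gt0// invrK mulrC -ler_pdivrMr//.
  by rewrite (le_trans hn)// ler_expR ler_nat.
exists (ex_minn ex); case: ex_minnP => -[|k] -> /= kmin.
  by rewrite oppr0 expR0 mulr1.
by rewrite ltNge; apply/negP => /kmin; rewrite ltnn.
Qed.

Lemma far_scale rho t : 0 < rho -> rho <= t ->
  exists k, rho * expR k%:R <= t < rho * expR k.+1%:R.
Proof.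
move=> rho0 trho.
have ex : exists k, t < rho * expR k.+1%:R.
  have [n hn] := ler_nat_expR (t / rho); exists n.
  rewrite mulrC -ltr_pdivrMr// (le_lt_trans hn)// ltr_expR ltr_nat//.
exists (ex_minn ex); case: ex_minnP => -[|k] -> /= kmin; rewrite andbT.
  by rewrite expR0 mulr1.
by rewrite leNgt; apply/negP => /kmin; rewrite ltnn.
Qed.

End ExponentialScales.

Section PowerKernels.
Context {R : realType} {dM : measure_display} {M : measurableType dM}.
Variables (d : M -> M -> R) (Y : set M) (nu : {measure set M -> \bar R}).
Variables c ups : R.
Hypotheses (dmet : is_metric d) (mY : measurable Y)
  (mopen : forall U, d_open d U -> measurable (U `&` Y))
  (nuY : (nu Y < +oo)%E) (c0 : 0 <= c)
  (ahl : forall x s, Y x -> 0 < s -> (nu (dball d Y x s) <= (c * s `^ ups)%:E)%E).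

Definition near s rho : M -> M -> \bar R :=
  shell d Y (fun k => (rho * expR (- k.+1%:R)) `^ (- s)) (fun k => rho * expR (- k%:R)).

Definition far s rho : M -> M -> \bar R :=
  shell d Y (fun k => (rho * expR k%:R) `^ (- s)) (fun k => rho * expR k.+1%:R).

(** At [s = ups] all scales contribute equally and the full series diverges, so only the [n] scales
    needed to reach across [Y] are kept. *)
Definition far_trunc n s rho : M -> M -> \bar R :=
  shell d Y (fun k => if (k < n)%N then (rho * expR k%:R) `^ (- s) else 0)
    (fun k => rho * expR k.+1%:R).

Let r0 rho : 0 < rho -> forall x : R, 0 < rho * expR x.
Proof. by move=> rho0 x; rewrite mulr_gt0 ?expR_gt0. Qed.

Let ler_npowR s (t u : R) : 0 <= s -> 0 < t -> t <= u -> u `^ (- s) <= t `^ (- s).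
Proof.
move=> s0 t0 tu; have u0 : 0 < u := lt_le_trans t0 tu.
by rewrite !powRN lef_pV2 ?posrE ?powR_gt0// ge0_ler_powR// nnegrE ltW.
Qed.

Lemma near_ge s rho x y : 0 <= s -> Y y -> 0 < d x y -> d x y < rho ->
  ((d x y `^ (- s))%:E <= near s rho x y)%E.
Proof.
move=> s0 Yy xy0 xyrho; have [k /andP[hk kh]] := near_scale xy0 xyrho.
apply: le_trans (shell_ge (k := k) _ Yy kh); last by move=> ?; exact: powR_ge0.
by rewrite lee_fin ler_npowR// r0// (lt_trans xy0).
Qed.

(** All the balls contain their centre, and since [0 <= s] no weight is smaller than the first one,
    so the partial sums grow at least linearly. *)
Lemma near_diag s rho x : 0 <= s -> 0 < rho -> Y x -> near s rho x x = +oo%E.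
Proof.
move=> s0 rho0 Yx; apply: eq_infty => A.
pose a0 := (rho * expR (- 1)) `^ (- s).
have a0_gt0 : 0 < a0 by rewrite powR_gt0// r0.
pose n := (Num.truncn (A / a0)).+1.
apply: le_trans (nneseries_lim_ge n _); last first.
  by move=> k _ _; rewrite lee_fin mulr_ge0 ?powR_ge0.
apply: (@le_trans _ _ (\sum_(0 <= k < n) a0%:E)%E); last first.
  apply: lee_sum => k _; rewrite lee_fin indicE mem_set ?mulr1.
    apply: ler_npowR => //; first exact: r0.
    by rewrite ler_pM2l// ler_expR lerN2 ler1n.
  by split => //; rewrite /ball_d /= (dist_refl dmet) r0.
rewrite sumEFin lee_fin sumr_const_nat subn0 -mulr_natr mulrC -ler_pdivrMr//.
exact/ltW/truncnS_gt.
Qed.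

(** [C] does not depend on [rho], so the mass of the kernel near the diagonal tends to 0 with [rho],
    uniformly in [x]. *)
Lemma integral_near s : s < ups -> exists2 C, 0 <= C & forall rho x, 0 < rho ->
  Y x -> (\int[nu]_(y in Y) near s rho x y <= (C * rho `^ (ups - s))%:E)%E.
Proof.
move=> sups; have q1 : expR (- (ups - s)) < 1 by rewrite expR_lt1 oppr_lt0 subr_gt0.
exists (c * expR s / (1 - expR (- (ups - s)))).
  by rewrite divr_ge0 ?subr_ge0 ?(ltW q1)// mulr_ge0 ?expR_ge0.
move=> rho x rho0 Yx.
apply: (integral_shell_le dmet mY mopen _ ahl) => // [k|k|n]; [exact: powR_ge0|exact: r0|].
under eq_bigr => k _ do rewrite mulrCA near_term// !mulrA.
apply: le_trans (geometric_sum_le _ _ _ _) _ => //; last 1 first.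
- by rewrite le_eqVlt; apply/orP; left; apply/eqP; ring.
- by rewrite !mulr_ge0 ?powR_ge0 ?expR_ge0.
- exact: expR_gt0.
Qed.

Lemma integral_far s : ups < s -> exists2 C, 0 <= C & forall rho x, 0 < rho ->
  Y x -> (\int[nu]_(y in Y) far s rho x y <= (C * rho `^ (ups - s))%:E)%E.
Proof.
move=> sups; have q1 : expR (- (s - ups)) < 1 by rewrite expR_lt1 oppr_lt0 subr_gt0.
exists (c * expR ups / (1 - expR (- (s - ups)))).
  by rewrite divr_ge0 ?subr_ge0 ?(ltW q1)// mulr_ge0 ?expR_ge0.
move=> rho x rho0 Yx.
apply: (integral_shell_le dmet mY mopen _ ahl) => // [k|k|n]; [exact: powR_ge0|exact: r0|].
under eq_bigr => k _ do rewrite mulrCA far_term// !mulrA.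
apply: le_trans (geometric_sum_le _ _ _ _) _ => //; last 1 first.
- by rewrite le_eqVlt; apply/orP; left; apply/eqP; ring.
- by rewrite !mulr_ge0 ?powR_ge0 ?expR_ge0.
- exact: expR_gt0.
Qed.

Lemma integral_far_trunc n rho x : 0 < rho -> Y x ->
  (\int[nu]_(y in Y) far_trunc n ups rho x y <= (c * expR ups * n%:R)%:E)%E.
Proof.
move=> rho0 Yx.
apply: (integral_shell_le dmet mY mopen _ ahl) => // [k|k|m]; [|exact: r0|].
  by case: ifP => // _; exact: powR_ge0.
apply: (@le_trans _ _ (\sum_(k < m) (if (k < n)%N then c * expR ups else 0))).
  apply: ler_sum => k _; case: ifP => _; last by rewrite mul0r.
  by rewrite mulrCA far_term// !subrr powRr0 oppr0 expR0 expr1n mul1r mulr1.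
(* At most [n] of the terms are nonzero, however large [m] is. *)
rewrite -big_mkcond /= -(big_mkord (fun k => (k < n)%N) (fun=> c * expR ups)).
rewrite big_const_seq iter_addr_0 -(mulr_natr (c * expR ups)).
rewrite ler_wpM2l ?mulr_ge0 ?expR_ge0// ler_nat.
rewrite -size_filter -[leqRHS](size_iota 0 n).
apply: uniq_leq_size; first by rewrite filter_uniq// iota_uniq.
by move=> k; rewrite mem_filter mem_iota => /andP[-> _].
Qed.

Lemma far_ge s rho x y : 0 <= s -> Y y -> 0 < rho -> rho <= d x y ->
  ((d x y `^ (- s))%:E <= far s rho x y)%E.
Proof.
move=> s0 Yy rho0 xy; have [k /andP[hk kh]] := far_scale rho0 xy.
apply: le_trans (shell_ge (k := k) _ Yy kh); last by move=> ?; exact: powR_ge0.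
by rewrite lee_fin ler_npowR// r0.
Qed.

Lemma far_trunc_ge n s rho x y : 0 <= s -> Y y -> 0 < rho -> rho <= d x y ->
  d x y < rho * expR n%:R -> ((d x y `^ (- s))%:E <= far_trunc n s rho x y)%E.
Proof.
move=> s0 Yy rho0 xy xyn; have [k /andP[hk kh]] := far_scale rho0 xy.
have kn : (k < n)%N.
  have := le_lt_trans hk xyn.
  by rewrite ltr_pM2l// ltr_expR ltr_nat.
apply: le_trans (shell_ge (k := k) _ Yy kh).
  by rewrite kn lee_fin ler_npowR// r0.
by move=> j; case: ifP => // _; exact: powR_ge0.
Qed.

Lemma near_dominated s : s < ups -> exists2 C, 0 <= C & forall rho (w : M -> R),
  0 < rho -> measurable_fun Y w -> (forall y, Y y -> 0 <= w y) ->
  (\int[nu]_(y in Y) (w y)%:E < +oo)%E ->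
  exists W : M -> \bar R, [/\ measurable_fun Y W, forall x, (0 <= W x)%E,
    forall x, Y x -> (\int[nu]_(y in Y) ((w y)%:E * near s rho x y) <= W x)%E &
    (\int[nu]_(x in Y) W x <=
      (C * rho `^ (ups - s))%:E * \int[nu]_(y in Y) (w y)%:E)%E].
Proof.
move=> sups; have q1 : expR (- (ups - s)) < 1 by rewrite expR_lt1 oppr_lt0 subr_gt0.
exists (c * 5 `^ ups * expR s / (1 - expR (- (ups - s)))).
  by rewrite divr_ge0 ?subr_ge0 ?(ltW q1)// !mulr_ge0 ?expR_ge0 ?powR_ge0.
move=> rho w rho0 mw w0 wfin.
pose a k := (rho * expR (- k.+1%:R)) `^ (- s).
have a0 k : 0 <= a k by exact: powR_ge0.
pose r k := rho * expR (- k%:R).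
pose A k := c * (5 * r k) `^ ups.
have A0 k : 0 <= A k by rewrite mulr_ge0 ?powR_ge0.
have /choice[F HF] : forall k, exists F : M -> \bar R, [/\ measurable_fun Y F,
    forall x, (0 <= F x)%E,
    forall x, Y x -> (\int[nu]_(y in dball d Y x (r k)) (w y)%:E <= F x)%E &
    (\int[nu]_(x in Y) F x <= (A k)%:E * \int[nu]_(y in Y) (w y)%:E)%E].
  move=> k; apply: (ball_integral_dominated dmet) => //; first exact: r0.
  by move=> y Yy; apply: ahl => //; rewrite mulr_gt0// r0.
have F0 k x : (0 <= (a k)%:E * F k x)%E.
  by rewrite mule_ge0 ?lee_fin//; case: (HF k).
have mF k : measurable_fun Y (F k) by case: (HF k).
exists (fun x => \sum_(k <oo) (a k)%:E * F k x)%E; split.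
- by apply: ge0_emeasurable_sum => // k _; exact: measurable_funeM.
- by move=> x; exact: nneseries_ge0.
- move=> x Yx; rewrite (integral_shell nu dmet)//.
  apply: lee_nneseries => k.
    move=> _ _; rewrite mule_ge0 ?lee_fin ?powR_ge0 ?integral_ge0// => y [_ Yy].
    by rewrite lee_fin w0.
  by move=> _; rewrite lee_wpmul2l ?lee_fin ?powR_ge0//; case: (HF k) => _ _ + _; exact.
rewrite integral_nneseries//; last by move=> k; exact: measurable_funeM.
have w_ge0 : (0 <= \int[nu]_(y in Y) (w y)%:E)%E.
  by apply: integral_ge0 => y Yy; rewrite lee_fin w0.
have /fineK <- : (\int[nu]_(y in Y) (w y)%:E)%E \is a fin_num.
  by rewrite ge0_fin_numE.
set I := fine _.
have IE : I%:E = (\int[nu]_(y in Y) (w y)%:E)%E by rewrite fineK// ge0_fin_numE.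
have I0 : 0 <= I by rewrite -lee_fin IE.
apply: (@le_trans _ _ (\sum_(k <oo) (I * (a k * A k))%:E)%E).
  apply: lee_nneseries => k.
    by move=> _ _; apply: integral_ge0.
  move=> _; rewrite ge0_integralZl//; [|by move=> x _; case: (HF k)|by rewrite lee_fin].
  rewrite mulrCA EFinM lee_wpmul2l ?lee_fin// mulrC EFinM IE.
  by case: (HF k).
apply: (@nneseries_EFin_le R (fun k => I * (a k * A k))) => [k|n].
  exact/(mulr_ge0 I0)/mulr_ge0.
rewrite -mulr_sumr mulrC ler_wpM2r//.
under eq_bigr => k _.
  rewrite /A powRM ?ltW ?r0// [c * (_ * _)]mulrA mulrCA near_term// !mulrA.
  over.
apply: le_trans (geometric_sum_le _ _ _ _) _ => //; last 1 first.
- by rewrite le_eqVlt; apply/orP; left; apply/eqP; ring.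
- by rewrite !mulr_ge0 ?powR_ge0 ?expR_ge0.
- exact: expR_gt0.
Qed.

End PowerKernels.

(** * Almost everywhere boundedness *)

Section AeBound.
Context {R : realType} {dM : measure_display} {M : measurableType dM}.
Variables (d : M -> M -> R) (Y : set M) (nu : {measure set M -> \bar R}).
Variables c ups : R.
Hypotheses (dmet : is_metric d) (mY : measurable Y)
  (mopen : forall U, d_open d U -> measurable (U `&` Y))
  (nuY : (nu Y < +oo)%E) (c0 : 0 <= c)
  (ahl : forall x s, Y x -> 0 < s -> (nu (dball d Y x s) <= (c * s `^ ups)%:E)%E).

Let measurable_near s rho D x : measurable_fun D (near d Y s rho x).
Proof. by apply: (measurable_shell dmet mopen) => k; exact: powR_ge0. Qed.

Let near_ge0 s rho x y : (0 <= near d Y s rho x y)%E.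
Proof. by apply: shell_ge0 => k; exact: powR_ge0. Qed.

(* For [rho] small, [T w x = Ck * \int w * near s rho x] has norm at most 1/2 both on
   bounded functions and on L^1. From [h <= G + T h] one gets [u <= T u] for
   [u = max (h - 2 G) 0], so [\int u <= 1/2 \int u], that is, [u = 0] a.e. *)
Lemma ae_bounded_of_potential (h : M -> R) (Ck s : R) : 0 <= Ck -> s < ups ->
  measurable_fun Y h -> (forall y, Y y -> 0 <= h y) ->
  (\int[nu]_(y in Y) (h y)%:E < +oo)%E ->
  (forall rho, 0 < rho -> exists2 G, 0 <= G & {ae nu, forall x, Y x ->
    ((h x)%:E <=
      G%:E + Ck%:E * \int[nu]_(y in Y) ((h y)%:E * near d Y s rho x y))%E}) ->
  exists2 B, 0 <= B & {ae nu, forall x, Y x -> h x <= B}.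
Proof.
move=> Ck0 sups mh h0 hfin hT.
have [C1 C10 I1] := integral_near dmet mY mopen c0 ahl sups.
have [C2 C20 I2] := near_dominated dmet mY mopen nuY c0 ahl sups.
have den : 0 < 2 * (Ck * (C1 + C2) + 1).
  by rewrite mulr_gt0// ltr_wpDl// mulr_ge0// addr_ge0.
(* [T] is the value of [rho ^ (ups - s)] that makes both norms at most 1/2; the summand 1 guards
   against a zero denominator. *)
pose T := (2 * (Ck * (C1 + C2) + 1))^-1.
have T0 : 0 < T by rewrite invr_gt0.
pose rho := T `^ (ups - s)^-1.
have rho0 : 0 < rho by rewrite powR_gt0.
have rhoE : rho `^ (ups - s) = T.
  by rewrite -powRrM mulVf ?powRr1 ?ltW// gt_eqF// subr_gt0.
have TE : T * (Ck * (C1 + C2) + 1) = 2^-1.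
  by rewrite /T invfM -mulrA mulVf ?mulr1// gt_eqF// ltr_wpDl// mulr_ge0// addr_ge0.
have half1 : Ck * (C1 * T) <= 2^-1.
  have : 0 <= Ck * (C2 * T) by rewrite !mulr_ge0// ltW.
  have := ltW T0; move: TE; lra.
have half2 : Ck * (C2 * T) <= 2^-1.
  have : 0 <= Ck * (C1 * T) by rewrite !mulr_ge0// ltW.
  have := ltW T0; move: TE; lra.
have [G G0 hG] := hT _ rho0.
pose u x := Num.max (h x - 2 * G) 0.
have u0 x : 0 <= u x by rewrite le_max lexx orbT.
have mu_ : measurable_fun Y u.
  by apply: measurable_maxr => //; exact: measurable_funB.
have muE : measurable_fun Y (fun y => (u y)%:E) by exact/measurable_EFinP.
have mhE : measurable_fun Y (fun y => (h y)%:E) by exact/measurable_EFinP.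
have uh : (\int[nu]_(y in Y) (u y)%:E <= \int[nu]_(y in Y) (h y)%:E)%E.
  apply: ge0_le_integral => //.
  - by move=> y _; rewrite lee_fin.
  - by move=> y Yy; rewrite lee_fin ge_max h0// andbT gerBl mulr_ge0.
have ufin := le_lt_trans uh hfin.
have [W [mW W0 uW IW]] := I2 rho u rho0 mu_ (fun y _ => u0 y) ufin.
have uCW : {ae nu, forall x, Y x -> ((u x)%:E <= Ck%:E * W x)%E}.
  apply: filterS hG => x hx Yx; have {hx} := hx Yx.
  have hle : (\int[nu]_(y in Y) ((h y)%:E * near d Y s rho x y) <=
      (2 * G * (C1 * T))%:E + W x)%E.
    apply: (@le_trans _ _ (\int[nu]_(y in Y) ((2 * G)%:E * near d Y s rho x y
        + (u y)%:E * near d Y s rho x y))%E).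
      apply: ge0_le_integral => //.
      - by move=> y Yy; rewrite mule_ge0// lee_fin h0.
      - exact: emeasurable_funM.
      - by apply: emeasurable_funD; apply: emeasurable_funM => //.
      - move=> y Yy; rewrite -ge0_muleDl ?lee_fin ?mulr_ge0//.
        rewrite lee_wpmul2r// -EFinD lee_fin -lerBlDl le_max lexx//.
    rewrite ge0_integralD//; last 4 first.
    - by move=> y Yy; rewrite mule_ge0// lee_fin mulr_ge0.
    - by apply: emeasurable_funM.
    - by move=> y Yy; rewrite mule_ge0// lee_fin.
    - exact: emeasurable_funM.
    apply: leeD; last exact: uW.
    rewrite ge0_integralZl ?lee_fin ?mulr_ge0//.
    by rewrite [leRHS]EFinM lee_wpmul2l ?lee_fin ?mulr_ge0// -rhoE I1.
  move=> hx.
  have {}hx : ((h x)%:E <= (2 * G)%:E + Ck%:E * W x)%E.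
    apply: le_trans hx _.
    apply: (@le_trans _ _ (G%:E + Ck%:E * ((2 * G * (C1 * T))%:E + W x))%E).
      by rewrite leeD2l// lee_wpmul2l// lee_fin.
    have W0x := W0 x.
    rewrite ge0_muleDr// ?lee_fin ?mulr_ge0// ?(ltW T0)//.
    rewrite addeA leeD2r// -EFinM -EFinD lee_fin.
    (* The potential of the constant [2 * G] is at most [G]; together with the [G] of the hypothesis
       it gives back [2 * G], which explains the truncation level. *)
    have : G * (Ck * (C1 * T)) <= G * 2^-1 by rewrite ler_wpM2l.
    lra.
  have CW0 : (0 <= Ck%:E * W x)%E by rewrite mule_ge0 ?lee_fin.
  rewrite /u EFin_max ge_max CW0 andbT EFinB leeBlDl//.
have u_half : (\int[nu]_(y in Y) (u y)%:E <= 2^-1%:E * \int[nu]_(y in Y) (u y)%:E)%E.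
  apply: (@le_trans _ _ (\int[nu]_(x in Y) (Ck%:E * W x))%E).
    apply: ae_ge0_le_integral => //.
    - by move=> y _; rewrite lee_fin.
    - by move=> y _; rewrite mule_ge0 ?lee_fin.
    - exact: measurable_funeM.
  rewrite ge0_integralZl ?lee_fin//.
  apply: (@le_trans _ _ (Ck%:E * ((C2 * T)%:E * \int[nu]_(y in Y) (u y)%:E))%E).
    by rewrite lee_wpmul2l ?lee_fin// -rhoE.
  rewrite muleA -EFinM lee_wpmul2r ?lee_fin//.
  by apply: integral_ge0 => y _; rewrite lee_fin.
(* A number that is at most its own half vanishes once it is nonnegative and finite; finiteness
   comes from [u <= h]. *)
have Iu0 : (\int[nu]_(y in Y) `|(u y)%:E| = 0)%E.
  under eq_integral do rewrite gee0_abs ?lee_fin//.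
  have I0 : (0 <= \int[nu]_(y in Y) (u y)%:E)%E.
    by apply: integral_ge0 => y _; rewrite lee_fin.
  move: u_half I0 ufin; case: (integral _ _ _) => [r| |]//=.
  rewrite -EFinM !lee_fin => r1 r2 _; congr EFin; lra.
have ae0 := (ae_eq_integral_abs nu mY muE).1 Iu0.
exists (2 * G); first by rewrite mulr_ge0.
apply: filterS ae0 => x hx Yx; have [] : ((u x)%:E = 0%:E)%E := hx Yx.
rewrite /u; have [hG0 _|hG0 hG1] := ltP (h x - 2 * G) 0; move: hG0; lra.
Qed.

End AeBound.

(** * The integral operator *)

Section LayerOperator.
Context {R : realType} {dM : measure_display} {M : measurableType dM}.
Variables (d : M -> M -> R) (Y : set M) (nu : {measure set M -> \bar R}).
Variables c ups : R.
Hypotheses (dmet : is_metric d) (mY : measurable Y)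
  (mopen : forall U, d_open d U -> measurable (U `&` Y))
  (nuY : (nu Y < +oo)%E) (c0 : 0 <= c)
  (ahl : forall x s, Y x -> 0 < s -> (nu (dball d Y x s) <= (c * s `^ ups)%:E)%E).
Variables (K : M -> M -> R[i]) (mu : M -> R[i]) (s1 s2 s3 C1 C2 : R).
Hypotheses (s10 : 0 <= s1) (s1ups : s1 < ups) (C10 : 0 < C1) (C20 : 0 <= C2)
  (mK : forall x, Y x -> cmeasurable Y (K x))
  (KC1 : forall x y, Y x -> Y y -> x <> y -> cabs (K x y) <= C1 * d x y `^ (- s1))
  (KC2 : forall x' x'' y, Y x' -> Y x'' -> x' <> x'' -> Y y ->
    2 * d x' x'' <= d x' y ->
    cabs (K x' y - K x'' y) <= C2 * d x' x'' `^ s3 * d x' y `^ (- s2))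
  (mmu : cmeasurable Y mu).

Let measurable_near s rho D x : measurable_fun D (near d Y s rho x).
Proof. by apply: (measurable_shell dmet mopen) => k; exact: powR_ge0. Qed.

Let near_ge0 s rho x y : (0 <= near d Y s rho x y)%E.
Proof. by apply: shell_ge0 => k; exact: powR_ge0. Qed.

Let A := layer_op nu Y K mu.

Let mKmu x : Y x -> cmeasurable Y (fun y => K x y * mu y).
Proof. by move=> Yx; apply: cmeasurableM => //; exact: mK. Qed.

(* Whatever the value [K x x], the bound holds at [y = x], where [near] is infinite. *)
Lemma kernel_le_near rho x y : 0 < rho -> Y x -> Y y -> d x y < rho ->
  ((cabs (K x y))%:E <= C1%:E * near d Y s1 rho x y)%E.
Proof.
move=> rho0 Yx Yy xy; have [->|xDy] := pselect (x = y).
  by rewrite (near_diag dmet)// gt0_muley ?lte_fin// leey.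
apply: (@le_trans _ _ (C1 * d x y `^ (- s1))%:E); first by rewrite lee_fin KC1.
rewrite EFinM lee_wpmul2l ?lee_fin ?(ltW C10)//.
by apply: near_ge => //; exact: dist_gt0.
Qed.

Lemma kernel_le_near_add rho x y : 0 < rho -> Y x -> Y y ->
  ((cabs (K x y))%:E <= C1%:E * near d Y s1 rho x y + (C1 * rho `^ (- s1))%:E)%E.
Proof.
move=> rho0 Yx Yy; have [xy|xy] := ltP (d x y) rho.
  apply: le_trans (kernel_le_near rho0 Yx Yy xy) _.
  by apply: leeDl; rewrite lee_fin mulr_ge0 ?powR_ge0// ltW.
have xDy : x <> y by move=> xy_eq; move: xy; rewrite xy_eq (dist_refl dmet) leNgt rho0.
apply: (@le_trans _ _ (C1 * d x y `^ (- s1))%:E); first by rewrite lee_fin KC1.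
apply: (@le_trans _ _ (C1 * rho `^ (- s1))%:E).
  rewrite lee_fin ler_pM2l// !powRN lef_pV2 ?posrE ?powR_gt0//; last exact: dist_gt0.
  by rewrite ge0_ler_powR// nnegrE ltW// (lt_le_trans rho0).
by apply: leeDr; rewrite mule_ge0// lee_fin ltW.
Qed.

(** The second term, independent of [x], is the part of the kernel that maps L^1 to bounded
    functions. Each factor 2 comes from estimating real and imaginary parts separately. *)
Lemma layer_op_le_potential rho x : 0 < rho -> Y x ->
  ((cabs (A x))%:E <=
    (2 * C1)%:E * \int[nu]_(y in Y) ((cabs (mu y))%:E * near d Y s1 rho x y) +
    (2 * (C1 * rho `^ (- s1)))%:E * \int[nu]_(y in Y) (cabs (mu y))%:E)%E.
Proof.
move=> rho0 Yx; apply: le_trans (cabs_cintegral_le nu mY (mKmu Yx)) _.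
have mh := measurable_cabsE mmu.
have Cr0 : 0 <= C1 * rho `^ (- s1) by rewrite mulr_ge0 ?powR_ge0// ltW.
have mn : measurable_fun Y (fun y => (cabs (mu y))%:E * near d Y s1 rho x y)%E.
  exact: emeasurable_funM.
have n0 y : Y y -> (0 <= (cabs (mu y))%:E * near d Y s1 rho x y)%E.
  by move=> _; rewrite mule_ge0// lee_fin cabs_ge0.
rewrite !EFinM -!muleA -ge0_muleDr//; last 2 first.
- by rewrite mule_ge0 ?lee_fin ?(ltW C10)//; exact: integral_ge0.
- rewrite muleA -EFinM mule_ge0 ?lee_fin// integral_ge0// => y _.
  by rewrite lee_fin cabs_ge0.
rewrite lee_wpmul2l ?lee_fin// muleA -EFinM.
rewrite -ge0_integralZl ?lee_fin ?(ltW C10)//.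
rewrite -ge0_integralZl//; last by move=> y _; rewrite lee_fin cabs_ge0.
rewrite -ge0_integralD//; last 4 first.
- by move=> y Yy; rewrite mule_ge0 ?n0 ?lee_fin ?(ltW C10).
- exact: measurable_funeM.
- by move=> y Yy; rewrite mule_ge0 ?lee_fin ?cabs_ge0.
- exact: measurable_funeM.
apply: ge0_le_integral => //.
- by move=> y _; rewrite lee_fin cabs_ge0.
- exact/measurable_cabsE/mKmu.
- by apply: emeasurable_funD; exact: measurable_funeM.
move=> y Yy; rewrite cabsM [leLHS]EFinM [leLHS]muleC.
rewrite [X in (_ <= X + _)%E]muleCA [X in (_ <= _ + X)%E]muleC -ge0_muleDr.
- by rewrite lee_wpmul2l ?lee_fin ?cabs_ge0//; exact: kernel_le_near_add.
- by rewrite mule_ge0// lee_fin ltW.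
- by rewrite lee_fin.
Qed.

Variable B : R.
Hypotheses (B0 : 0 <= B) (muB : {ae nu, forall y, Y y -> cabs (mu y) <= B}).

Lemma integral_cabsM_le (q : M -> R[i]) : cmeasurable Y q ->
  (\int[nu]_(y in Y) (cabs (q y * mu y))%:E <=
   B%:E * \int[nu]_(y in Y) (cabs (q y))%:E)%E.
Proof.
move=> mq; have mqE := measurable_cabsE mq.
rewrite -ge0_integralZl//; last by move=> y _; rewrite lee_fin cabs_ge0.
apply: ae_ge0_le_integral => //.
- by move=> y _; rewrite lee_fin cabs_ge0.
- exact/measurable_cabsE/cmeasurableM.
- by move=> y _; rewrite mule_ge0 ?lee_fin ?cabs_ge0.
- exact: measurable_funeM.
apply: filterS muB => y yB Yy.
by rewrite cabsM -EFinM lee_fin mulrC ler_wpM2r ?cabs_ge0 ?yB.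
Qed.

Lemma integral_kernel_le D : 0 < D -> (forall x y, Y x -> Y y -> d x y < D) ->
  exists2 C, 0 <= C & forall x, Y x ->
    (\int[nu]_(y in Y) (cabs (K x y))%:E <= C%:E)%E.
Proof.
move=> D0 diamY.
have [C C0 HC] := integral_near dmet mY mopen c0 ahl s1ups.
exists (C1 * (C * D `^ (ups - s1))); first by rewrite !mulr_ge0 ?powR_ge0// ltW.
move=> x Yx; apply: (@le_trans _ _ (\int[nu]_(y in Y) (C1%:E * near d Y s1 D x y))%E).
  apply: ge0_le_integral => //.
  - by move=> y _; rewrite lee_fin cabs_ge0.
  - exact/measurable_cabsE/mK.
  - exact: measurable_funeM.
  - by move=> y Yy; apply: kernel_le_near => //; exact: diamY.
rewrite ge0_integralZl ?lee_fin ?(ltW C10)// EFinM lee_wpmul2l ?lee_fin ?(ltW C10)//.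
exact: HC.
Qed.

Lemma layer_op_bounded D : 0 < D -> (forall x y, Y x -> Y y -> d x y < D) ->
  exists2 C, 0 <= C & forall x, Y x -> cabs (A x) <= C.
Proof.
move=> D0 diamY; have [C C0 HC] := integral_kernel_le D0 diamY.
exists (2 * (B * C)); first by rewrite !mulr_ge0.
move=> x Yx; rewrite -lee_fin; apply: le_trans (cabs_cintegral_le nu mY (mKmu Yx)) _.
rewrite EFinM lee_wpmul2l ?lee_fin//.
apply: le_trans (integral_cabsM_le (mK Yx)) _.
by rewrite EFinM lee_wpmul2l ?lee_fin// HC.
Qed.

(* [far'] stands for any majorant of [d x' y `^ (- s2)] off the ball [B(x', 2 d x' x'')]. *)
Lemma layer_op_holder D : 0 < D -> (forall x y, Y x -> Y y -> d x y < D) ->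
  exists2 C, 0 <= C & forall x' x'' (far' : M -> \bar R) P,
    Y x' -> Y x'' -> x' <> x'' ->
    measurable_fun Y far' -> (forall y, 0 <= far' y)%E ->
    (forall y, Y y -> 2 * d x' x'' <= d x' y ->
      ((d x' y `^ (- s2))%:E <= far' y)%E) ->
    (\int[nu]_(y in Y) far' y <= P%:E)%E ->
    cabs (A x' - A x'') <= C * (d x' x'' `^ (ups - s1) + d x' x'' `^ s3 * P).
Proof.
move=> D0 diamY; have [CD CD0 HCD] := integral_kernel_le D0 diamY.
have [C C0 HC] := integral_near dmet mY mopen c0 ahl s1ups.
(* The ball of radius [2 t] at [x'] lies in the one of radius [3 t] at [x'']. On it the two kernels
   are estimated separately, without using cancellation. *)
pose E := C1 * C * (2 `^ (ups - s1) + 3 `^ (ups - s1)).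
have E0 : 0 <= E by rewrite !mulr_ge0 ?addr_ge0 ?powR_ge0// ltW.
exists (2 * (B * (E + C2))); first by rewrite !mulr_ge0// addr_ge0.
move=> x' x'' far' P Yx' Yx'' xx mfar far0 farK farP.
set t := d x' x''; have t0 : 0 < t by exact: dist_gt0.
have t20 : 0 < 2 * t by rewrite mulr_gt0.
have t30 : 0 < 3 * t by rewrite mulr_gt0.
have fin x : Y x -> (\int[nu]_(y in Y) (cabs (K x y * mu y))%:E < +oo)%E.
  move=> Yx; apply: le_lt_trans (integral_cabsM_le (mK Yx)) _.
  apply: (@le_lt_trans _ _ (B%:E * CD%:E)%E); last by rewrite -EFinM ltry.
  by rewrite lee_wpmul2l ?lee_fin// HCD.
have mdK : cmeasurable Y (fun y => K x' y - K x'' y).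
  by apply: cmeasurableB; exact: mK.
have P0 : 0 <= P.
  by rewrite -lee_fin; apply: le_trans farP; exact: integral_ge0.
have AE : A x' - A x'' = cintegral nu Y (fun y => (K x' y - K x'' y) * mu y).
  rewrite /A /layer_op cintegralB ?fin//; try exact: mKmu.
  by congr cintegral; apply/funext => y; rewrite mulrBl.
rewrite -lee_fin AE.
apply: le_trans (cabs_cintegral_le nu mY (cmeasurableM mdK mmu)) _.
rewrite -mulrA EFinM lee_wpmul2l ?lee_fin//.
apply: le_trans (integral_cabsM_le mdK) _.
rewrite -mulrA EFinM lee_wpmul2l ?lee_fin//.
apply: (@le_trans _ _ (\int[nu]_(y in Y) (C1%:E * near d Y s1 (2 * t) x' y
    + C1%:E * near d Y s1 (3 * t) x'' y + (C2 * t `^ s3)%:E * far' y))%E).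
  have nn r x y : (0 <= C1%:E * near d Y s1 r x y)%E.
    by rewrite mule_ge0 ?lee_fin ?(ltW C10).
  have ff y : (0 <= (C2 * t `^ s3)%:E * far' y)%E.
    by rewrite mule_ge0 ?lee_fin ?mulr_ge0 ?powR_ge0.
  apply: ge0_le_integral => //.
  - by move=> y _; rewrite lee_fin cabs_ge0.
  - exact: measurable_cabsE.
  - apply: emeasurable_funD; last exact: measurable_funeM.
    by apply: emeasurable_funD; exact: measurable_funeM.
  move=> y Yy; have [ty|ty] := ltP (d x' y) (2 * t).
    apply: (@le_trans _ _ ((cabs (K x' y))%:E + (cabs (K x'' y))%:E)%E).
      by rewrite -EFinD lee_fin cabsB.
    apply: le_trans (leeDl _ (ff y)).
    apply: leeD; apply: kernel_le_near => //.
    have := dist_tri dmet x' x'' y; rewrite (distC dmet x'' x') -/t; lra.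
  apply: le_trans (leeDr _ (adde_ge0 (nn _ _ _) (nn _ _ _))).
  apply: (@le_trans _ _ (C2 * t `^ s3 * d x' y `^ (- s2))%:E).
    by rewrite lee_fin KC2.
  by rewrite EFinM lee_wpmul2l ?lee_fin ?mulr_ge0 ?powR_ge0// farK.
have t3 : 0 <= t `^ s3 by exact: powR_ge0.
have tu : 0 <= t `^ (ups - s1) by exact: powR_ge0.
rewrite !ge0_integralD//;
  do ?[by move=> y _; rewrite ?adde_ge0// mule_ge0 ?lee_fin ?mulr_ge0// (ltW C10)];
  do ?[exact: measurable_funeM|by apply: emeasurable_funD; exact: measurable_funeM].
rewrite !ge0_integralZl ?lee_fin ?mulr_ge0 ?(ltW C10)//.
apply: (@le_trans _ _ ((C1%:E * (C * (2 * t) `^ (ups - s1))%:E +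
    C1%:E * (C * (3 * t) `^ (ups - s1))%:E) + (C2 * t `^ s3)%:E * P%:E)%E).
  apply: leeD; last by rewrite lee_wpmul2l ?lee_fin ?mulr_ge0.
  by apply: leeD; rewrite lee_wpmul2l ?lee_fin ?(ltW C10)// HC.
rewrite -!EFinM -!EFinD lee_fin !powRM ?(ltW t0)// [leRHS]mulrDl mulrDr.
(* [h1] and [h2] are the cross terms by which the product on the right exceeds the left-hand
   side. *)
have h1 : 0 <= E * (t `^ s3 * P) by exact/(mulr_ge0 E0)/mulr_ge0.
have h2 : 0 <= C2 * t `^ (ups - s1) by rewrite !mulr_ge0.
rewrite -subr_ge0; apply: le_trans (addr_ge0 h1 h2) _.
by rewrite le_eqVlt; apply/orP; left; apply/eqP; rewrite /E; ring.
Qed.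

(** The majorant is [near] at radius [D] for [s2 < ups], [far_trunc] for equality, and [far]
    otherwise. For distances up to [expR (- s3^-1)], which is at most 1, the smaller exponent in a
    minimum gives the larger power. *)
Lemma layer_op_modulus D : 0 < D -> (forall x y, Y x -> Y y -> d x y < D) ->
  0 <= s2 -> 0 < s3 <= 1 ->
  exists2 C, 0 <= C & forall x' x'', Y x' -> Y x'' -> x' <> x'' ->
    d x' x'' <= expR (- s3^-1) ->
    cabs (A x' - A x'') <= C * varpi ups s1 s2 s3 (d x' x'').
Proof.
move=> D0 diamY s20 s301; have [s30 s31] := andP s301.
have [CH CH0 HH] := layer_op_holder D0 diamY.
have mshell a r x : (forall k, 0 <= a k) -> measurable_fun Y (shell d Y a r x).
  by move=> a0; exact: (measurable_shell dmet mopen).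
have dt x' x'' : x' <> x'' -> d x' x'' <= expR (- s3^-1) ->
    0 < d x' x'' /\ d x' x'' <= 1.
  move=> xx ts; split; first exact: dist_gt0.
  exact: le_trans ts (small_le1 s30).
have [lt2|ge2] := ltP s2 ups.
  have [C C0 HC] := integral_near dmet mY mopen c0 ahl lt2.
  pose P := C * D `^ (ups - s2).
  have P0 : 0 <= P by rewrite mulr_ge0 ?powR_ge0.
  exists (CH * (1 + P)); first by rewrite mulr_ge0 ?addr_ge0.
  move=> x' x'' Yx' Yx'' xx ts; have [t0 t1] := dt _ _ xx ts.
  apply: le_trans (HH x' x'' (near d Y s2 D x') P Yx' Yx'' xx _ _ _ (HC D x' D0 Yx')) _.
  - exact: measurable_near.
  - exact: near_ge0.
  - move=> y Yy ty; apply: near_ge => //; last exact: diamY.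
    by apply: lt_le_trans ty; rewrite mulr_gt0.
  rewrite /varpi gt_eqF// lt2 -mulrA ler_wpM2l// mulrDl mul1r lerD//.
    by apply: powR_decr => //; rewrite ge_min lexx.
  rewrite mulrC ler_wpM2l//.
  by apply: powR_decr => //; rewrite ge_min lexx orbT.
have [eq2|ne2] := eqVneq s2 ups.
  have [N DN] := ler_nat_expR D.
  pose Q := c * expR ups * (N%:R + 2).
  have ce0 : 0 <= c * expR ups by rewrite mulr_ge0 ?expR_ge0.
  have Q0 : 0 <= Q by rewrite mulr_ge0 ?addr_ge0.
  exists (CH * (1 + Q)); first by rewrite mulr_ge0 ?addr_ge0.
  move=> x' x'' Yx' Yx'' xx ts; have [t0 t1] := dt _ _ xx ts.
  have L1 := abs_ln_ge1 s301 t0 ts.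
  set t := d x' x'' in t0 t1 ts L1 *; set L := `|ln t| in L1.
  (* [m] scales lead from [t] up to 1 and [N] more from 1 up to [D]. Since [1 <= L], their number is
     at most [(N + 2) * L]. *)
  pose m := (Num.truncn L).+1; pose n := (N + m)%N.
  have mL : m%:R <= L + 1.
    by rewrite /m -natr1 lerD2r truncn_le ?normr_ge0.
  have tm : 1 <= t * expR m%:R.
    rewrite -{1}(lnK (x := t)) ?posrE// -expRD -[leLHS]expR0 ler_expR.
    have := truncnS_gt L; rewrite -/m.
    have : - ln t <= L by rewrite /L -normrN ler_norm.
    lra.
  have t20 : 0 < 2 * t by rewrite mulr_gt0.
  apply: le_trans (HH x' x'' (far_trunc d Y n s2 (2 * t) x') (c * expR ups * n%:R)
    Yx' Yx'' xx _ _ _ _) _.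
  - by apply: mshell => k; case: ifP => // _; exact: powR_ge0.
  - by move=> y; apply: shell_ge0 => k; case: ifP => // _; exact: powR_ge0.
  - move=> y Yy ty; apply: far_trunc_ge => //.
    apply: lt_le_trans (diamY _ _ Yx' Yy) _; apply: le_trans DN _.
    rewrite /n natrD expRD mulrCA ler_peMr ?expR_ge0// -mulrA.
    by apply: le_trans tm _; rewrite ler_peMl ?ler1n// mulr_ge0 ?expR_ge0// ltW.
  - by rewrite eq2; exact: (integral_far_trunc dmet mY mopen c0 ahl).
  rewrite /varpi -/t gt_eqF// ltNge ge2 eq2 eqxx /= -(mulrA CH) ler_wpM2l// mulrDl mul1r.
  apply: lerD; first by rewrite le_max lexx.
  apply: (@le_trans _ _ (Q * omega_th s3 t)); last first.
    by rewrite ler_wpM2l// le_max lexx orbT.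
  rewrite omega_thE// [leRHS]mulrCA ler_wpM2l ?powR_ge0//.
  rewrite /Q -(mulrA (c * expR ups)) ler_wpM2l// /n natrD mulrDl -/L lerD//.
    by rewrite ler_peMr.
  by apply: le_trans mL _; lra.
have gt2 : ups < s2 by rewrite lt_neqAle eq_sym ne2.
have [C C0 HC] := integral_far dmet mY mopen c0 ahl gt2.
pose P := C * 2 `^ (ups - s2).
have P0 : 0 <= P by rewrite mulr_ge0 ?powR_ge0.
exists (CH * (1 + P)); first by rewrite mulr_ge0 ?addr_ge0.
move=> x' x'' Yx' Yx'' xx ts; have [t0 t1] := dt _ _ xx ts.
set t := d x' x'' in t0 t1 ts *.
have t20 : 0 < 2 * t by rewrite mulr_gt0.
apply: le_trans (HH x' x'' (far d Y s2 (2 * t) x') (C * (2 * t) `^ (ups - s2))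
  Yx' Yx'' xx _ _ _ (HC _ x' t20 Yx')) _.
- by apply: mshell => k; exact: powR_ge0.
- by move=> y; apply: shell_ge0 => k; exact: powR_ge0.
- by move=> y Yy ty; exact: far_ge.
rewrite /varpi -/t gt_eqF// ltNge ge2 (negbTE ne2) /=.
rewrite -mulrA ler_wpM2l// [leRHS]mulrDl mul1r lerD//.
  by apply: powR_decr => //; rewrite ge_min lexx.
rewrite powRM ?(ltW t0)// [C * _]mulrA -/P mulrCA ler_wpM2l//.
rewrite -powRD ?(gt_eqF t0) ?implybT//.
by apply: powR_decr => //; rewrite ge_min addrA lexx orbT.
Qed.

End LayerOperator.

(** * Global constants extracted from the hypotheses *)

Section BoundedSets.
Context {R : realType} {dM : measure_display} {M : measurableType dM}.
Variables (d : M -> M -> R) (Y : set M) (nu : {measure set M -> \bar R}) (ups : R).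
Hypotheses (dmet : is_metric d) (mY : measurable Y)
  (mopen : forall U, d_open d U -> measurable (U `&` Y)).

Lemma d_boundedP : d_bounded d Y ->
  exists2 D, 0 < D & forall x y, Y x -> Y y -> d x y < D.
Proof.
move=> [C HC]; exists (`|C| + 1); first by rewrite ltr_wpDl.
move=> x y Yx Yy; apply: le_lt_trans (HC x y Yx Yy) _.
by rewrite (le_lt_trans (ler_norm C))// ltrDl.
Qed.

Lemma finite_measure_bounded : d_bounded d Y ->
  (forall x r, Y x -> 0 < r -> (nu (ball_d d x r `&` Y) < +oo)%E) -> (nu Y < +oo)%E.
Proof.
move=> /d_boundedP[D D0 diamY] nufin.
have [->|/set0P[x Yx]] := eqVneq Y set0; first by rewrite measure0.
rewrite (_ : Y = ball_d d x D `&` Y); first exact: nufin.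
by apply/seteqP; split => [y Yy|y []//]; split => //; exact: diamY.
Qed.

(** Beyond a finite radius [rho] not exceeding [r0], the total mass suffices, since
    [(s / rho) ^ ups] is then at least 1. *)
Lemma upper_ahlfors_all_radii : (nu Y < +oo)%E -> 0 < ups ->
  upper_ahlfors d nu ups Y ->
  exists2 c, 0 <= c & forall x s, Y x -> 0 < s ->
    (nu (dball d Y x s) <= (c * s `^ ups)%:E)%E.
Proof.
move=> nuY ups0 [r0 [c0 [r0_gt0 [c0_gt0 H]]]].
have [rho rho0 rhor0] : exists2 rho : R, 0 < rho & (rho%:E <= r0)%E.
  case: r0 r0_gt0 {H} => [r| |]//; first by rewrite lte_fin => r_gt0; exists r.
  by move=> _; exists 1 => //; rewrite leey.
have nuE : nu Y = (fine (nu Y))%:E by rewrite fineK// ge0_fin_numE.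
set V := fine (nu Y) in nuE.
have V0 : 0 <= V by rewrite fine_ge0.
have Vr0 : 0 <= V / rho `^ ups by rewrite divr_ge0 ?powR_ge0.
exists (c0 + V / rho `^ ups); first by rewrite addr_ge0// ltW.
move=> x s Yx s0; have [srho|rhos] := ltP s rho.
  apply: (le_trans (H x s Yx s0 _)); first by apply: lt_le_trans rhor0; rewrite lte_fin.
  by rewrite lee_fin ler_wpM2r ?powR_ge0// lerDl.
apply: (@le_trans _ _ (nu Y)).
  apply: le_measure; rewrite ?inE//; first exact: measurable_dball.
  by move=> y [].
rewrite nuE lee_fin mulrDl; apply: (@le_trans _ _ (V / rho `^ ups * s `^ ups)).
  rewrite -mulrA ler_peMr// mulrC ler_pdivlMr ?powR_gt0// mul1r.
  by rewrite ge0_ler_powR// ?nnegrE ltW// (lt_le_trans rho0).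
by rewrite lerDr mulr_ge0 ?powR_ge0// ltW.
Qed.

(** Integrate [h <= 1 + h ^ 2] over a set of finite measure. *)
Lemma L2_integrable_cabs (mu : M -> R[i]) : (nu Y < +oo)%E -> L2 nu Y mu ->
  (\int[nu]_(y in Y) (cabs (mu y))%:E < +oo)%E.
Proof.
move=> nuY [mmu mu2]; have mh := measurable_cabs mmu.
have mh2 : measurable_fun Y (fun y => ((cabs (mu y)) ^+ 2)%:E).
  by apply/measurable_EFinP; exact: measurable_funX.
apply: (@le_lt_trans _ _ (\int[nu]_(y in Y) (1%:E + ((cabs (mu y)) ^+ 2)%:E))%E).
  apply: ge0_le_integral => //.
  - by move=> y _; rewrite lee_fin cabs_ge0.
  - exact/measurable_EFinP.
  - exact: emeasurable_funD.
  - move=> y _; rewrite -EFinD lee_fin.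
    have := sqr_ge0 (cabs (mu y) - 1); have := cabs_ge0 (mu y).
    by move: (cabs _) => h; rewrite sqrrB1; lra.
rewrite ge0_integralD//; last by move=> y _; rewrite lee_fin sqr_ge0.
by rewrite integral_cst// mul1e lte_add_pinfty.
Qed.

End BoundedSets.

Section KernelClass.
Context {R : realType} {M : Type}.
Variables (d : M -> M -> R) (Y : set M) (s1 s2 s3 : R) (K : M -> M -> R[i]).
Hypotheses (dist_gt0 : forall x y, x <> y -> 0 < d x y)
  (HK : kernel_class d s1 s2 s3 Y K).

(** The constant is made strictly positive so that its product with [+oo] on the diagonal is [+oo]
    and not 0. *)
Lemma kernel_class_size : exists2 C, 0 < C & forall x y, Y x -> Y y -> x <> y ->
  cabs (K x y) <= C * d x y `^ (- s1).
Proof.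
case: HK => _ [[C HC] _]; exists (`|C| + 1); first by rewrite ltr_wpDl.
move=> x y Yx Yy xy; have p0 : 0 < d x y `^ s1 by rewrite powR_gt0// dist_gt0.
rewrite powRN ler_pdivlMr// mulrC (le_trans (HC x y Yx Yy xy))//.
by rewrite (le_trans (ler_norm C))// lerDl.
Qed.

Lemma kernel_class_smooth : exists2 C, 0 <= C & forall x' x'' y,
  Y x' -> Y x'' -> x' <> x'' -> Y y -> 2 * d x' x'' <= d x' y ->
  cabs (K x' y - K x'' y) <= C * d x' x'' `^ s3 * d x' y `^ (- s2).
Proof.
case: HK => _ [_ [C HC]]; exists `|C| => // x' x'' y Yx' Yx'' xx Yy xy.
have t0 := dist_gt0 xx.
have xy0 : 0 < d x' y by apply: lt_le_trans xy; rewrite mulr_gt0.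
have p0 : 0 < d x' x'' `^ s3 by rewrite powR_gt0.
have q0 : 0 < d x' y `^ s2 by rewrite powR_gt0.
rewrite powRN ler_pdivlMr// mulrC -ler_pdivrMr// mulrAC.
apply: le_trans (HC x' x'' y Yx' Yx'' xx Yy _) (ler_norm C).
by rewrite /ball_d /= ltNge xy.
Qed.

End KernelClass.

(** * Regularity of the representative [g + A[K, mu]] *)

Unset Implicit Arguments.

Theorem theorem6p1 (R : realType) (dM : measure_display) (M : measurableType dM)
  (d : M -> M -> R) (Y : set M) (nu : {measure set M -> \bar R})
  (upsY theta s1 s2 s3 : R) (K : M -> M -> R[i]) (g mu : M -> R[i]) :
  is_metric d ->
  d_bounded d Y ->
  (* the sigma-algebra on Y (traces on Y of measurable sets of M) contains
     the Borel subsets of Y *)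
  measurable Y ->
  (forall U, d_open d U -> measurable (U `&` Y)) ->
  (forall x r, Y x -> 0 < r -> (nu (ball_d d x r `&` Y) < +oo)%E) ->
  0 < upsY ->
  upper_ahlfors d nu upsY Y ->
  0 < theta <= 1 ->
  0 <= s1 -> upsY - 1 <= s1 -> s1 < upsY ->
  0 <= s2 ->
  0 < s3 <= 1 ->
  (s2 = upsY -> strongly_upper_ahlfors d nu upsY Y) ->
  (upsY < s2 -> s2 < upsY + s3) ->
  kernel_class d s1 s2 s3 Y K ->
  Cb_hold d theta Y g ->
  L2 nu Y mu ->
  {ae nu, forall x, Y x -> mu x - layer_op nu Y K mu x = g x} ->
  exists mu' : M -> R[i],
    {ae nu, forall x, Y x -> mu' x = mu x} /\
    Cb_omega d (fun r => if r == 0 then 0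
                         else Num.max (r `^ theta) (varpi upsY s1 s2 s3 r)) Y mu'.
Proof.
move=> dmet bY mY mopen nufin ups0 ahlY /andP[theta0 _] s10 _ s1ups s20 s301 _ s2ups.
move=> HK [cont_g [[Gb0 HGb0] [Cg0 HCg0]]] muL2 mu_eq.
have mmu := muL2.1; have [s30 _] := andP s301.
have nuY := finite_measure_bounded bY nufin.
have [D D0 diamY] := d_boundedP bY.
have [c c0 ahl] := upper_ahlfors_all_radii dmet mY mopen nuY ups0 ahlY.
have [C1 C10 KC1] := kernel_class_size (@dist_gt0 _ _ _ _ dmet) HK.
have [C2 C20 KC2] := kernel_class_smooth (@dist_gt0 _ _ _ _ dmet) HK.
have mK x : Y x -> cmeasurable Y (K x).
  by move=> Yx; apply: (cmeasurable_kernel dmet) => //; case: HK.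
have hfin := L2_integrable_cabs mY nuY muL2.
have [Gb Gb_ge0 HGb] : exists2 G, 0 <= G & forall x, Y x -> cabs (g x) <= G.
  by exists `|Gb0| => // x Yx; rewrite (le_trans (HGb0 x Yx))// ler_norm.
have [Cg Cg_ge0 HCg] : exists2 C, 0 <= C & forall x y, Y x -> Y y -> x <> y ->
    cabs (g x - g y) <= C * d x y `^ theta.
  exists `|Cg0| => // x y Yx Yy xy.
  rewrite -ler_pdivrMr ?powR_gt0 ?(dist_gt0 dmet)//.
  by rewrite (le_trans (HCg0 x y Yx Yy xy))// ler_norm.
have [B B0 muB] : exists2 B, 0 <= B & {ae nu, forall x, Y x -> cabs (mu x) <= B}.
  apply: (ae_bounded_of_potential dmet mY mopen nuY c0 ahl (Ck := 2 * C1) (s := s1)).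
  - by rewrite mulr_ge0// ltW.
  - exact: s1ups.
  - exact: measurable_cabs.
  - by move=> y _; exact: cabs_ge0.
  - exact: hfin.
  move=> rho rho0.
  have I0 : (0 <= \int[nu]_(y in Y) (cabs (mu y))%:E)%E.
    by apply: integral_ge0 => y _; rewrite lee_fin cabs_ge0.
  have IE : (\int[nu]_(y in Y) (cabs (mu y))%:E)%E =
      (fine (\int[nu]_(y in Y) (cabs (mu y))%:E)%E)%:E.
    by rewrite fineK// ge0_fin_numE.
  set I := fine _ in IE.
  (* The bound of [g] plus the contribution of the kernel beyond distance [rho]; it may blow up as
     [rho] shrinks, since [rho] is fixed before [G]. *)
  exists (Gb + 2 * (C1 * rho `^ (- s1)) * I).
    by rewrite addr_ge0// !mulr_ge0 ?powR_ge0 ?fine_ge0// ltW.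
  apply: filterS mu_eq => x mux Yx.
  have -> : mu x = g x + layer_op nu Y K mu x by rewrite -mux// subrK.
  apply: (@le_trans _ _ ((cabs (g x))%:E + (cabs (layer_op nu Y K mu x))%:E)%E).
    by rewrite -EFinD lee_fin cabsD.
  rewrite EFinD -addeA; apply: leeD; first by rewrite lee_fin HGb.
  rewrite addeC (EFinM _ I) -IE.
  exact: (layer_op_le_potential nu dmet mY mopen s10 C10 mK KC1 mmu).
have [MA MA0 HMA] := layer_op_bounded dmet mY mopen c0 ahl s10 s1ups C10 mK KC1 mmu
  B0 muB D0 diamY.
have [CA CA0 HCA] := layer_op_modulus dmet mY mopen c0 ahl s10 s1ups C10 C20 mK KC1
  KC2 mmu B0 muB D0 diamY s20 s301.
exists (fun x => g x + layer_op nu Y K mu x); split.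
  by apply: filterS mu_eq => x mux Yx; rewrite -mux// subrK.
set A := layer_op nu Y K mu in HMA HCA *.
pose t := expR (- s3^-1); have t0 : 0 < t := expR_gt0 _.
have splitE x y : g x + A x - (g y + A y) = (g x - g y) + (A x - A y).
  by rewrite opprD addrACA.
split; last split.
- move=> x Yx e e0.
  have [del1 del10 Hg] := cont_g x Yx (e / 2) (divr_gt0 e0 (ltr0n _ 2)).
  have [C [a [C0 a0 HC]]] := varpi_le_powR s1ups s30 s2ups.
  (* [q] is a size of [d x y ^ a] for which [CA * C * d x y ^ a] stays below [e / 2], also when
     [CA * C] is 0. *)
  pose q := e / 2 / (CA * C + 1).
  have CC0 : 0 <= CA * C by rewrite mulr_ge0.
  have q0 : 0 < q by rewrite !divr_gt0// ltr_wpDl.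
  exists (Num.min del1 (Num.min t (q `^ a^-1))).
    by rewrite !lt_min del10 t0 powR_gt0.
  move=> y Yy; rewrite !lt_min => /andP[xy1 /andP[xyt xyq]].
  rewrite splitE; apply: le_lt_trans (cabsD _ _) _.
  rewrite [ltRHS](splitr e); apply: ltr_leD; first exact: Hg.
  have [->|xy] := pselect (y = x).
    by rewrite subrr cabsE ComplexField.Normc.normc0 divr_ge0// ltW.
  have yx0 := dist_gt0 dmet xy.
  rewrite (distC dmet) in xyt xyq.
  apply: le_trans (HCA y x Yy Yx xy (ltW xyt)) _.
  apply: (@le_trans _ _ (CA * (C * q))).
    rewrite ler_wpM2l// (le_trans (HC _ yx0 (ltW xyt)))// ler_wpM2l//.
    have -> : q = (q `^ a^-1) `^ a by rewrite -powRrM mulVf ?powRr1 ?gt_eqF// ltW.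
    by rewrite ge0_ler_powR// ?nnegrE ?powR_ge0 ?ltW.
  rewrite /q mulrA mulrCA ler_piMr ?divr_ge0 ?(ltW e0)//.
  by rewrite ler_pdivrMr ?ltr_wpDl// mul1r lerDl.
- exists (Gb + MA) => x Yx; apply: le_trans (cabsD _ _) _.
  by apply: lerD; [exact: HGb|exact: HMA].
exists (Cg + CA + (MA + MA) / t `^ theta) => x y Yx Yy xy.
have xy0 := dist_gt0 dmet xy.
have p0 : 0 < d x y `^ theta by rewrite powR_gt0.
rewrite gt_eqF//; set m := Num.max _ _.
have pm : d x y `^ theta <= m by rewrite le_max lexx.
have m0 : 0 < m := lt_le_trans p0 pm.
have tth : 0 < t `^ theta by rewrite powR_gt0.
rewrite ler_pdivrMr// splitE; apply: le_trans (cabsD _ _) _.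
rewrite -addrA mulrDl; apply: lerD.
  by rewrite (le_trans (HCg x y Yx Yy xy))// ler_wpM2l.
have MA2 : 0 <= (MA + MA) / t `^ theta by rewrite divr_ge0 ?addr_ge0// ltW.
have [xyt|txy] := leP (d x y) t.
  apply: le_trans (HCA x y Yx Yy xy xyt) _.
  apply: (@le_trans _ _ (CA * m)); first by rewrite ler_wpM2l// le_max lexx orbT.
  by rewrite ler_wpM2r ?(ltW m0)// lerDl.
apply: (@le_trans _ _ ((MA + MA) / t `^ theta * m)).
  apply: (@le_trans _ _ (MA + MA)).
    by apply: le_trans (cabsB _ _) _; apply: lerD; exact: HMA.
  rewrite -mulrA ler_peMr ?addr_ge0// mulrC ler_pdivlMr// mul1r.
  apply: le_trans pm; rewrite ge0_ler_powR// ?nnegrE ?ltW//.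
by rewrite ler_wpM2r ?(ltW m0)// lerDr.
Qed.
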